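(* Let $S(x)=\sum_{n\ge0}S_{n+1}\frac{x^n}{n!}$, $S^\circ(x)=\sum_{n\ge0}S_{n+1}^\circ\frac{x^n}{n!}$, $\Pi(x)=1+\sum_{n\ge1}\pi_n\frac{x^n}{n!}$ and $\Pi^\circ(x)=1-\sum_{n\ge1}\pi_n^\circ\frac{x^n}{n!}$ in $\mathfrak P\otimes\mathbb Q[[x]]$. Then $$S^\circ(x)=e^{-x}\,\Pi^\circ(x)\,S(x)=e^{-x}\,\Pi(x)^{-1}S(x).$$
   Context: $\mathfrak P$ is the commutative ring freely generated as an abelian group by combinatorial equivalence classes of convex polytopes, with multiplication the Cartesian product; the point is the unit $1$. For a polytope $Q$, let $\mathcal F(Q)$ be the set of nonempty faces of $Q$ (including $Q$), regarded as elements of $\mathfrak P$, and define the motivic interior $Q^\circ=\sum_{f\in\mathcal F(Q)}(-1)^{\operatorname{codim} f}f$. For a connected simple graph $\Gamma$ on $[n]$, the graph-associahedron is $P_\Gamma=\{x\in\mathbb R^n:\sum_i x_i=3^n,\ \sum_{i\in S}x_i\ge3^{|S|}\text{ for all proper nonempty }S\subset[n]\text{ with }\Gamma|_S\text{ connected}\}$. The stellohedron $S_n$ is $P_\Gamma$ for $\Gamma$ the star graph with $n$ vertices (one central vertex joined to $n-1$ leaves), an $(n-1)$-dimensional polytope ($S_1$ a point). The permutohedron $\pi_n$ is $P_\Gamma$ for $\Gamma$ the complete graph on $n$ vertices, i.e. the convex hull of the permutations of $(1,\dots,n)$. $S_n^\circ,\pi_n^\circ$ are the motivic interiors. *)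

(* Defs.v *)
From HB Require Import structures.
From mathcomp Require Import all_boot all_order all_algebra.
From mathcomp Require Import finmap generic_quotient.
From mathcomp Require Import boolp classical_sets functions cardinality fsbigop.
From mathcomp Require Import reals.
From mathcomp Require Import monalg ring lra zify.

Set Implicit Arguments.
Unset Strict Implicit.
Unset Printing Implicit Defensive.

Import Order.TTheory GRing.Theory Num.Theory.
Local Open Scope classical_set_scope.
Local Open Scope ring_scope.

Section FormalPowerSeries.
Variable A : comNzRingType.

Record fps := Fps { fcoef : nat -> A }.

HB.instance Definition _ := gen_eqMixin fps.
HB.instance Definition _ := gen_choiceMixin fps.

Lemma fpsP (f g : fps) : (forall n, fcoef f n = fcoef g n) -> f = g.
Proof. by case: f g => [f] [g] /= fg; congr Fps; apply/funext. Qed.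

Definition fps_add (f g : fps) := Fps (fun n => fcoef f n + fcoef g n).
Definition fps_opp (f : fps) := Fps (fun n => - fcoef f n).
Definition fps_zero := Fps (fun=> 0).
Definition fps_one := Fps (fun n => (n == 0%N)%:R).
Definition fps_mul (f g : fps) :=
  Fps (fun n => \sum_(i < n.+1) fcoef f i * fcoef g (n - i)%N).

Fact fps_addA : associative fps_add.
Proof. by move=> f g h; apply: fpsP => n /=; rewrite addrA. Qed.
Fact fps_addC : commutative fps_add.
Proof. by move=> f g; apply: fpsP => n /=; rewrite addrC. Qed.
Fact fps_add0 : left_id fps_zero fps_add.
Proof. by move=> f; apply: fpsP => n /=; rewrite add0r. Qed.
Fact fps_addN : left_inverse fps_zero fps_opp fps_add.
Proof. by move=> f; apply: fpsP => n /=; rewrite addNr. Qed.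
HB.instance Definition _ :=
  GRing.isZmodule.Build fps fps_addA fps_addC fps_add0 fps_addN.

Let trunc N (f : fps) : {poly A} := \poly_(i < N) fcoef f i.

Let trunc_mul N (f g : fps) n : (n < N)%N ->
  fcoef (fps_mul f g) n = (trunc N f * trunc N g)`_n.
Proof.
move=> nN; rewrite coefM /=; apply: eq_bigr => i _; rewrite !coef_poly.
have iN : (i < N)%N by apply: leq_ltn_trans nN; rewrite -ltnS.
by rewrite iN (leq_ltn_trans (leq_subr _ _) nN).
Qed.

Fact fps_mulA : associative fps_mul.
Proof.
move=> f g h; apply: fpsP => n.
have E (a b : fps) (c : {poly A}) :
    (trunc n.+1 (fps_mul a b) * c)`_n = (trunc n.+1 a * trunc n.+1 b * c)`_n.
  rewrite !coefM; apply: eq_bigr => i _; congr (_ * _).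
  by rewrite coef_poly ltn_ord (trunc_mul _ _ (ltn_ord i)).
rewrite !(@trunc_mul n.+1) // E [trunc _ f * _]mulrC E.
by rewrite [_ * trunc _ f]mulrC mulrA.
Qed.
Fact fps_mulC : commutative fps_mul.
Proof. by move=> f g; apply: fpsP => n; rewrite !(@trunc_mul n.+1) // mulrC. Qed.
Fact fps_mul1 : left_id fps_one fps_mul.
Proof.
move=> f; apply: fpsP => n /=; rewrite big_ord_recl /= mul1r subn0 big1 ?addr0//.
by move=> i _; rewrite mul0r.
Qed.
Fact fps_mulDl : left_distributive fps_mul fps_add.
Proof.
move=> f g h; apply: fpsP => n /=; rewrite -big_split /=.
by apply: eq_bigr => i _; rewrite mulrDl.
Qed.
Fact fps_oner_neq0 : fps_one != 0 :> fps.
Proof. by apply/eqP => /(congr1 (fcoef^~ 0%N)) /= /eqP; rewrite oner_eq0. Qed.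

HB.instance Definition _ := GRing.Zmodule_isComNzRing.Build fps
  fps_mulA fps_mulC fps_mul1 fps_mulDl fps_oner_neq0.

Lemma fcoef0 n : fcoef (0 : fps) n = 0. Proof. by []. Qed.
Lemma fcoef1 n : fcoef (1 : fps) n = (n == 0%N)%:R. Proof. by []. Qed.
Lemma fcoefD (f g : fps) n : fcoef (f + g) n = fcoef f n + fcoef g n.
Proof. by []. Qed.
Lemma fcoefN (f : fps) n : fcoef (- f) n = - fcoef f n. Proof. by []. Qed.
Lemma fcoefM (f g : fps) n :
  fcoef (f * g) n = \sum_(i < n.+1) fcoef f i * fcoef g (n - i)%N.
Proof. by []. Qed.

Definition fps_unit : {pred fps} := fun f => `[< exists g : fps, g * f = 1 >].
Definition fps_inv (f : fps) : fps :=
  if pselect (exists g : fps, g * f = 1) is left ex then projT1 (cid ex) else f.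

Fact fps_mulVr : {in fps_unit, left_inverse 1 fps_inv *%R}.
Proof.
move=> f /asboolP ex; rewrite /fps_inv.
by case: pselect => // ex'; case: cid.
Qed.
Fact fps_unitP (f g : fps) : g * f = 1 -> fps_unit f.
Proof. by move=> gf; apply/asboolP; exists g. Qed.
Fact fps_inv_out : {in [predC fps_unit], fps_inv =1 id}.
Proof.
by move=> f /asboolPn nex; rewrite /fps_inv; case: pselect.
Qed.
HB.instance Definition _ := GRing.ComNzRing_hasMulInverse.Build fps
  fps_mulVr fps_unitP fps_inv_out.

Lemma fps_unit1 (f : fps) : fcoef f 0 = 1 -> f \is a GRing.unit.
Proof.
move=> f0; pose h := 1 - f.
have hX k n : (n < k)%N -> fcoef (h ^+ k) n = 0.
  elim: k n => // k IHk n nk; rewrite exprS fcoefM big1 // => i _.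
  have [-> | i_gt0] := posnP (i : nat).
    by rewrite fcoefD fcoefN f0 fcoef1 subrr mul0r.
  rewrite IHk ?mulr0 //; rewrite ltnS in nk; apply: leq_trans nk.
  by rewrite ltn_subrL i_gt0 (leq_trans i_gt0) // -ltnS.
have fE : f = 1 - h by rewrite opprB addrC subrK.
apply/asboolP; exists (Fps (fun n => fcoef (\sum_(k < n.+1) h ^+ k) n)).
have sumE n i : (i <= n)%N ->
    fcoef (\sum_(k < i.+1) h ^+ k) i = fcoef (\sum_(k < n.+1) h ^+ k) i.
  move=> /subnK <-; elim: (n - i)%N => // d IHd.
  by rewrite addSn [in RHS]big_ord_recr fcoefD -IHd /= hX ?addr0 // ltnS leq_addl.
apply: fpsP => n; rewrite fcoefM /=.
under eq_bigr => i _ do rewrite (sumE n) -1?ltnS //.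
rewrite -fcoefM fE mulrC -opprB mulNr -subrX1 opprB fcoefD fcoefN hX //.
by rewrite subr0.
Qed.

End FormalPowerSeries.

Section Polytopes.
Variable R : realType.

Definition dot n (c : 'cV[R]_n) (x : 'rV[R]_n) : R := (x *m c) 0 0.

Lemma dot0 n (x : 'rV[R]_n) : dot 0 x = 0.
Proof. by rewrite /dot mulmx0 mxE. Qed.

Lemma dotN n (c : 'cV[R]_n) x : dot (- c) x = - dot c x.
Proof. by rewrite /dot mulmxN mxE. Qed.

Lemma dotD n (c : 'cV[R]_n) x y : dot c (x + y) = dot c x + dot c y.
Proof. by rewrite /dot mulmxDl mxE. Qed.

Lemma dotB n (c : 'cV[R]_n) x y : dot c (x - y) = dot c x - dot c y.
Proof. by rewrite /dot mulmxBl !mxE. Qed.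

Lemma dotZ n (c : 'cV[R]_n) a x : dot c (a *: x) = a * dot c x.
Proof. by rewrite /dot -scalemxAl mxE. Qed.

Lemma dot_col_mx n m (c : 'cV[R]_n) (d : 'cV[R]_m) x :
  dot (col_mx c d) x = dot c (lsubmx x) + dot d (rsubmx x).
Proof. by rewrite /dot -{1}(hsubmxK x) mul_row_col mxE. Qed.

Definition halfspaces n (s : seq ('cV[R]_n * R)) : set 'rV[R]_n :=
  [set x | forall h, h \in s -> dot h.1 x <= h.2].

Definition is_polytope n (P : set 'rV[R]_n) : Prop :=
  [/\ P !=set0,
      exists M, forall x, P x -> forall i, `|x 0 i| <= M
    & exists s, P = halfspaces s].

(* Polytopes are given by inequalities, as graph-associahedra are; the empty
   polytope is excluded. *)
Record polytope n := Polytope {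
  body :> set 'rV[R]_n;
  bodyP : is_polytope body }.

HB.instance Definition _ n := gen_eqMixin (polytope n).
HB.instance Definition _ n := gen_choiceMixin (polytope n).

Lemma polytope_inj n (P Q : polytope n) : body P = body Q -> P = Q.
Proof.
case: P Q => [P pP] [Q pQ] /= PQ; move: PQ pP pQ => -> pP pQ.
by congr Polytope; exact: Prop_irrelevance.
Qed.

Definition argmax n (P : set 'rV[R]_n) (c : 'cV[R]_n) : set 'rV[R]_n :=
  [set x | P x /\ forall y, P y -> dot c y <= dot c x].

(* [c = 0] gives P itself; the empty face is excluded. *)
Definition is_face n (P F : set 'rV[R]_n) : Prop :=
  F !=set0 /\ exists c, F = argmax P c.

Definition faces n (P : polytope n) : set (polytope n) :=
  [set F | is_face P F].

(* The dimension of the affine hull: the largest k such that P contains k + 1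
   affinely independent points. *)
Definition affdim n (P : set 'rV[R]_n) : nat :=
  \max_(k < n.+1 | `[< exists x (M : 'M[R]_(k, n)),
     [/\ P x, forall i, P (x + row i M) & row_free M] >]) k.

Definition codim n (Q F : set 'rV[R]_n) : nat := (affdim Q - affdim F)%N.

Lemma face_sub n (P F : set 'rV[R]_n) : is_face P F -> F `<=` P.
Proof. by move=> [_ [c ->]] x []. Qed.

Lemma face_self n (P : polytope n) : is_face P P.
Proof.
split; first by case: (bodyP P).
exists 0; apply/seteqP; split => x /=; last by case.
by move=> Px; split=> // y _; rewrite !dot0.
Qed.

Lemma face_polytope n (P : polytope n) F : is_face P F -> is_polytope F.
Proof.
move=> [F0 [c FE]]; case: (bodyP P) => P0 [M PM] [s Ps]; split=> //.
  by exists M => x; rewrite FE => -[/PM].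
case: (F0) => x; rewrite FE => -[Px xmax].
exists ((- c, - dot c x) :: s); apply/seteqP; split=> y.
  move=> [Py ymax] h; rewrite inE => /predU1P[-> /=|hs].
    by rewrite dotN lerN2; exact: ymax.
  by move: Py; rewrite Ps; exact.
move=> Hy; split.
  by rewrite Ps => h hs; apply: Hy; rewrite inE hs orbT.
move=> z Pz; apply: le_trans (xmax z Pz) _.
by have := Hy _ (mem_head _ _); rewrite /= dotN lerN2.
Qed.

Lemma convex_halfspaces n (s : seq ('cV[R]_n * R)) x y (t : R) :
  halfspaces s x -> halfspaces s y -> 0 <= t <= 1 ->
  halfspaces s (x + t *: (y - x)).
Proof.
move=> sx sy /andP[t0 t1] h hs.
rewrite dotD dotZ dotB.
have -> : dot h.1 x + t * (dot h.1 y - dot h.1 x) =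
          (1 - t) * dot h.1 x + t * dot h.1 y.
  by rewrite mulrBr mulrBl mul1r addrA addrAC.
have -> : h.2 = (1 - t) * h.2 + t * h.2 by rewrite -mulrDl subrK mul1r.
by apply: lerD; apply: ler_wpM2l; rewrite ?subr_ge0 //; [exact: sx|exact: sy].
Qed.

Lemma face_relint n (P F : set 'rV[R]_n) s : is_polytope F -> F `<=` P ->
  P = halfspaces s ->
  exists2 x, F x & forall h, h \in s ->
    (forall y, F y -> dot h.1 y = h.2) \/ dot h.1 x < h.2.
Proof.
move=> [F0 _ [t FE]] FP PE.
have Fle h y : h \in s -> F y -> dot h.1 y <= h.2.
  by move=> hs /FP; rewrite PE; exact.
have : {subset s <= s} by [].
elim: {-2}s => [|h s' IH] ss'; first by case: F0 => x Fx; exists x.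
have [|x Fx xP] := IH; first by move=> k ks; rewrite ss' // inE ks orbT.
have hs : h \in s by rewrite ss' // mem_head.
have [ht | hnt] := pselect (forall y, F y -> dot h.1 y = h.2).
  by exists x => // k; rewrite inE => /predU1P[->|/xP //]; left.
have [y Fy yh] : exists2 y, F y & dot h.1 y < h.2.
  have /existsNP[y /not_implyP[Fy /eqP yh]] := hnt.
  by exists y => //; rewrite lt_neqAle yh Fle.
exists (x + 2^-1 *: (y - x)).
  move: Fx Fy; rewrite FE => Fx Fy; apply: convex_halfspaces => //; lra.
move=> k; rewrite inE => ks'.
have ks : k \in s by apply: ss'; rewrite inE.
have dE : dot k.1 (x + 2^-1 *: (y - x)) = (dot k.1 x + dot k.1 y) / 2.
  by rewrite dotD dotZ dotB; field.
have := Fle _ _ ks Fx; have := Fle _ _ ks Fy; rewrite dE.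
case/predU1P: ks' => [->|/xP[|]]; [right; lra | by left | right; lra].
Qed.

Lemma face_tight n (P F : set 'rV[R]_n) s : is_polytope P -> is_face P F ->
  P = halfspaces s ->
  F = [set x | P x /\ forall h, h \in s ->
         (forall y, F y -> dot h.1 y = h.2) -> dot h.1 x = h.2].
Proof.
move=> pP FP PE; apply/seteqP; split=> [x Fx|x [Px xt]].
  by split=> [|h _]; [exact: face_sub FP _ Fx | exact].
have [z Fz zt] := face_relint (face_polytope (P := Polytope pP) FP)
  (face_sub FP) PE.
have Ple h y : h \in s -> P y -> dot h.1 y <= h.2 by move=> hs; rewrite PE; exact.
have Pz := face_sub FP Fz.
pose w (e : R) := z - e *: (x - z).
have wE (c : 'cV[R]_n) e : dot c (w e) = dot c z - e * (dot c x - dot c z).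
  by rewrite /w dotB dotZ dotB.
have [e e0 we] : exists2 e : R, 0 < e & P (w e).
  suff [e e0 we] : exists2 e : R, 0 < e & forall e', 0 < e' <= e ->
      forall h, h \in s -> dot h.1 (w e') <= h.2.
    by exists e => //; rewrite PE => h; apply: we; rewrite e0 lexx.
  have : {subset s <= s} by [].
  elim: {-2}s => [|h s' IH] ss'; first by exists 1.
  have [|e1 e1_gt0 we1] := IH; first by move=> k ks; rewrite ss' // inE ks orbT.
  have hs : h \in s by rewrite ss' // mem_head.
  case: (zt h hs) => [ht|hlt].
    exists e1 => // e' /we1 we' k; rewrite inE => /predU1P[->|/we' //].
    by rewrite wE xt // ht // subrr mulr0 subr0.
  pose d := h.2 - dot h.1 z; pose D := `|dot h.1 x - dot h.1 z| + 1.
  have d0 : 0 < d by rewrite subr_gt0.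
  have D0 : 0 < D by rewrite ltr_wpDl.
  exists (Num.min e1 (d / D)); first by rewrite lt_min e1_gt0 divr_gt0.
  move=> e'; rewrite le_min => /and3P[e'0 e'1 e'D] k.
  rewrite inE => /predU1P[->|]; last by apply: we1; rewrite e'0.
  rewrite wE; move: e'D; rewrite ler_pdivlMr // => e'D.
  have : - (e' * (dot h.1 x - dot h.1 z)) <= e' * D.
    rewrite -mulrN ler_pM2l // (@le_trans _ _ `|dot h.1 x - dot h.1 z|) //.
      by rewrite -normrN ler_norm.
    by rewrite lerDl.
  by move: e'D; rewrite /d; lra.
case: FP Fz => _ [c FE]; rewrite FE => -[_ zmax].
split=> // y Py; apply: le_trans (zmax y Py) _.
by have := zmax _ we; rewrite wE gerDl oppr_le0 pmulr_rge0 // subr_ge0.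
Qed.

Lemma finite_faces_set n (P : polytope n) : finite_set [set F | is_face P F].
Proof.
have [_ _ [s PE]] := bodyP P.
pose h0 : 'cV[R]_n * R := (0, 0).
pose G (T : {set 'I_(size s)}) : set 'rV[R]_n :=
  [set x | body P x /\ forall i, i \in T -> dot (nth h0 s i).1 x = (nth h0 s i).2].
apply: (@sub_finite_set _ _ [set G T | T in [set: {set 'I_(size s)}]]); last first.
  by apply: finite_image; exact: finite_finset.
move=> F FP; exists [set i : 'I_(size s) | `[< forall y, F y ->
  dot (nth h0 s i).1 y = (nth h0 s i).2 >]]%SET => //.
rewrite [RHS](face_tight (bodyP P) FP PE); apply/seteqP.
split=> x [Px xt]; split=> //.
  move=> h hs ht; have hi : (index h s < size s)%N by rewrite index_mem.
  have := xt (Ordinal hi); rewrite inE /= nth_index //; apply.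
  by apply/asboolP.
by move=> i; rewrite inE => /asboolP; apply: xt; rewrite mem_nth.
Qed.

Lemma finite_faces n (P : polytope n) : finite_set (faces P).
Proof.
apply: (@finite_preimage _ _ [set F | is_face P F] (@body n)).
  by move=> F G _ _; exact: polytope_inj.
exact: finite_faces_set.
Qed.

(* An isomorphism of the posets of nonempty faces; adding the empty face, this
   is the same as an isomorphism of face lattices. *)
Definition comb_equiv n m (P : set 'rV[R]_n) (Q : set 'rV[R]_m) : Prop :=
  exists f : set 'rV[R]_n -> set 'rV[R]_m,
    set_bij [set F | is_face P F] [set G | is_face Q G] f /\
    forall F G, is_face P F -> is_face P G -> (F `<=` G <-> f F `<=` f G).

Lemma comb_equivP n m (P : set 'rV[R]_n) (Q : set 'rV[R]_m) :
  comb_equiv P Q <-> exists (f : set 'rV[R]_n -> set 'rV[R]_m) g,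
    [/\ forall F, is_face P F -> is_face Q (f F) /\ g (f F) = F,
        forall G, is_face Q G -> is_face P (g G) /\ f (g G) = G,
        forall F F', is_face P F -> is_face P F' -> F `<=` F' -> f F `<=` f F' &
        forall G G', is_face Q G -> is_face Q G' -> G `<=` G' -> g G `<=` g G'].
Proof.
split=> [[f [[fPQ finj fsurj] fle]]|[f [g [fK gK fle gle]]]]; last first.
  exists f; split; last first.
    move=> F F' PF PF'; split=> [|ff]; first exact: fle.
    have [[QF fF] [QF' fF']] := (fK _ PF, fK _ PF').
    by rewrite -fF -fF'; exact: gle.
  split; first by move=> F /fK[].
    by move=> F F'; rewrite !inE => /fK[_ {2}<-] /fK[_ {2}<-] ->.
  by move=> G /gK[PG fG]; exists (g G).
have gex G : exists F, is_face Q G -> is_face P F /\ f F = G.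
  have [QG|nQG] := pselect (is_face Q G); last by exists set0.
  by have [F PF FG] := fsurj _ QG; exists F.
pose g G := projT1 (cid (gex G)).
have gK G : is_face Q G -> is_face P (g G) /\ f (g G) = G.
  by rewrite /g; case: cid.
exists f, g; split=> //.
- move=> F PF; have QF : is_face Q (f F) by exact: fPQ.
  split=> //; have [PgF fgF] := gK _ QF.
  by apply: finj; rewrite ?inE.
- by move=> F F' PF PF'; apply: (fle F F' PF PF').1.
- move=> G G' QG QG' GG'; have [[PG gG] [PG' gG']] := (gK _ QG, gK _ QG').
  by apply: (fle _ _ PG PG').2; rewrite gG gG'.
Qed.

Lemma comb_equiv_refl n (P : set 'rV[R]_n) : comb_equiv P P.
Proof. by apply/comb_equivP; exists id, id; split. Qed.

Lemma comb_equiv_sym n m (P : set 'rV[R]_n) (Q : set 'rV[R]_m) :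
  comb_equiv P Q -> comb_equiv Q P.
Proof.
move=> /comb_equivP[f [g [? ? ? ?]]].
by apply/comb_equivP; exists g, f; split.
Qed.

Lemma comb_equiv_trans n m p (P : set 'rV[R]_n) (Q : set 'rV[R]_m)
    (S : set 'rV[R]_p) :
  comb_equiv P Q -> comb_equiv Q S -> comb_equiv P S.
Proof.
move=> /comb_equivP[f [g [fK gK fle gle]]] /comb_equivP[h [k [hK kK hle kle]]].
apply/comb_equivP; exists (h \o f), (g \o k); split=> /=.
- move=> F PF; have [Qf gf] := fK _ PF; have [Sh kh] := hK _ Qf.
  by rewrite kh.
- move=> F PF; have [Qf gf] := kK _ PF; have [Sh kh] := gK _ Qf.
  by rewrite kh.
- move=> F F' PF PF' FF'; have [Qf _] := fK _ PF; have [Qf' _] := fK _ PF'.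
  by apply: hle => //; exact: fle.
- move=> F F' PF PF' FF'; have [Qf _] := kK _ PF; have [Qf' _] := kK _ PF'.
  by apply: gle => //; exact: kle.
Qed.

Lemma comb_equiv_iso n m (P : set 'rV[R]_n) (Q : set 'rV[R]_m)
    (u : 'rV[R]_n -> 'rV[R]_m) (v : 'rV[R]_m -> 'rV[R]_n) :
  (forall x, P x -> Q (u x) /\ v (u x) = x) ->
  (forall y, Q y -> P (v y) /\ u (v y) = y) ->
  (forall c, exists d, forall x, dot c (u x) = dot d x) ->
  (forall d, exists c, forall y, dot d (v y) = dot c y) ->
  comb_equiv P Q.
Proof.
have main k l (A : set 'rV[R]_k) (B : set 'rV[R]_l)
  (a : 'rV[R]_k -> 'rV[R]_l) (b : 'rV[R]_l -> 'rV[R]_k) :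
  (forall x, A x -> B (a x) /\ b (a x) = x) ->
  (forall y, B y -> A (b y) /\ a (b y) = y) ->
  (forall d, exists c, forall y, dot d (b y) = dot c y) ->
  forall F, is_face A F -> is_face B (a @` F) /\ b @` (a @` F) = F.
  move=> aK bK bl F FA; split; last first.
    rewrite image_comp; apply/seteqP; split=> [x [y Fy /= <-]|x Fx].
      by rewrite (aK _ (face_sub FA Fy)).2.
    by exists x => //=; rewrite (aK _ (face_sub FA Fx)).2.
  case: FA => [[x0 Fx0] [d FE]]; split; first by exists (a x0), x0.
  have [c dc] := bl d; exists c; apply/seteqP; split=> [y [x]|y [By ymax]].
    rewrite FE => -[Ax xmax] <-; have [Bax bax] := aK _ Ax; split=> // z Bz.
    by rewrite -!dc bax; apply: xmax; exact: (bK _ Bz).1.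
  have [Aby aby] := bK _ By; exists (b y) => //; rewrite FE; split=> // x Ax.
  have [Bax bax] := aK _ Ax; rewrite dc -bax dc; exact: ymax.
move=> uK vK ul vl; apply/comb_equivP.
exists (fun F => u @` F), (fun G => v @` G); split.
- exact: main.
- exact: main.
- by move=> F F' _ _ FF'; exact: image_subset.
- by move=> F F' _ _ FF'; exact: image_subset.
Qed.

Definition setprod n m (P : set 'rV[R]_n) (Q : set 'rV[R]_m) :
    set 'rV[R]_(n + m) :=
  [set x | P (lsubmx x) /\ Q (rsubmx x)].

Lemma setprod_row n m (P : set 'rV[R]_n) (Q : set 'rV[R]_m) x y :
  setprod P Q (row_mx x y) <-> P x /\ Q y.
Proof. by rewrite /setprod /= row_mxKl row_mxKr. Qed.

Lemma setprod_polytope n m (P : polytope n) (Q : polytope m) :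
  is_polytope (setprod P Q).
Proof.
case: P Q => [P [[x Px] [M PM] [s Ps]]] [Q [[y Qy] [N QN] [t Qt]]] /=; split.
- by exists (row_mx x y); apply/setprod_row.
- exists (Num.max M N) => z [/PM zM /QN zN] i; rewrite le_max -(splitK i).
  case: (fintype.split i) => j /=.
    by have := zM j; rewrite mxE => ->.
  by have := zN j; rewrite mxE => ->; rewrite orbT.
exists ([seq (col_mx h.1 0, h.2) | h <- s] ++ [seq (col_mx 0 h.1, h.2) | h <- t]).
apply/seteqP; split=> z; rewrite /setprod Ps Qt.
  move=> [zs zt] h; rewrite mem_cat => /orP[] /mapP[k ks ->] /=.
    by rewrite dot_col_mx dot0 addr0; exact: zs.
  by rewrite dot_col_mx dot0 add0r; exact: zt.
move=> H; split=> h hs.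
  have := H (col_mx h.1 0, h.2); rewrite mem_cat map_f //= => /(_ isT).
  by rewrite dot_col_mx dot0 addr0.
have := H (col_mx 0 h.1, h.2).
rewrite mem_cat (map_f (fun k => (col_mx 0 k.1, k.2)) hs) orbT /= => /(_ isT).
by rewrite dot_col_mx dot0 add0r.
Qed.

Definition polytope_prod n m (P : polytope n) (Q : polytope m) :
  polytope (n + m) := Polytope (setprod_polytope P Q).

Lemma setprod_sub n m (P P' : set 'rV[R]_n) (Q Q' : set 'rV[R]_m) :
  P `<=` P' -> Q `<=` Q' -> setprod P Q `<=` setprod P' Q'.
Proof. by move=> PP QQ z [/PP ? /QQ ?]. Qed.

Lemma setprodKl n m (P : set 'rV[R]_n) (Q : set 'rV[R]_m) :
  Q !=set0 -> lsubmx @` setprod P Q = P.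
Proof.
move=> [y Qy]; apply/seteqP; split=> [x [z [Pz _] <-] //|x Px].
by exists (row_mx x y); [apply/setprod_row | rewrite row_mxKl].
Qed.

Lemma setprodKr n m (P : set 'rV[R]_n) (Q : set 'rV[R]_m) :
  P !=set0 -> rsubmx @` setprod P Q = Q.
Proof.
move=> [x Px]; apply/seteqP; split=> [y [z [_ Qz] <-] //|y Qy].
by exists (row_mx x y); [apply/setprod_row | rewrite row_mxKr].
Qed.

Lemma face_setprod n m (P : set 'rV[R]_n) (Q : set 'rV[R]_m) F :
  is_face (setprod P Q) F <->
  exists A B, [/\ is_face P A, is_face Q B & F = setprod A B].
Proof.
split=> [[[z0 Fz0] [c FE]]|[A [B [[[x Ax] [c AE]] [[y By] [d BE]] ->]]]].
  have zE z : dot c z = dot (usubmx c) (lsubmx z) + dot (dsubmx c) (rsubmx z).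
    by rewrite -dot_col_mx vsubmxK.
  have FE' : F = setprod (argmax P (usubmx c)) (argmax Q (dsubmx c)).
    rewrite FE; apply/seteqP; split=> z.
      move=> [[Pz Qz] zmax]; split; split=> // w Pw.
        have /zmax : setprod P Q (row_mx w (rsubmx z)) by apply/setprod_row.
        by rewrite !zE row_mxKl row_mxKr lerD2r.
      have /zmax : setprod P Q (row_mx (lsubmx z) w) by apply/setprod_row.
      by rewrite !zE row_mxKl row_mxKr lerD2l.
    move=> [[Pz zP] [Qz zQ]]; split=> // w [Pw Qw].
    by rewrite !zE lerD ?zP ?zQ.
  have [Fl Fr] : setprod (argmax P (usubmx c)) (argmax Q (dsubmx c)) z0.
    by rewrite -FE'.
  exists (argmax P (usubmx c)), (argmax Q (dsubmx c)); split=> //.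
    by split; [exists (lsubmx z0) | exists (usubmx c)].
  by split; [exists (rsubmx z0) | exists (dsubmx c)].
split; first by exists (row_mx x y); apply/setprod_row.
exists (col_mx c d); rewrite AE BE; apply/seteqP; split=> z.
  move=> [[Pz zP] [Qz zQ]]; split=> // w [Pw Qw].
  by rewrite !dot_col_mx lerD ?zP ?zQ.
move=> [[Pz Qz] zmax]; split; split=> // w Pw.
  have /zmax : setprod P Q (row_mx w (rsubmx z)) by apply/setprod_row.
  by rewrite !dot_col_mx row_mxKl row_mxKr lerD2r.
have /zmax : setprod P Q (row_mx (lsubmx z) w) by apply/setprod_row.
by rewrite !dot_col_mx row_mxKl row_mxKr lerD2l.
Qed.

Lemma comb_equiv_setprod n n' m m' (P : set 'rV[R]_n) (P' : set 'rV[R]_n')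
    (Q : set 'rV[R]_m) (Q' : set 'rV[R]_m') :
  comb_equiv P P' -> comb_equiv Q Q' ->
  comb_equiv (setprod P Q) (setprod P' Q').
Proof.
move=> /comb_equivP[f [g [fK gK fle gle]]] /comb_equivP[h [k [hK kK hle kle]]].
pose pr a b c d (u : set 'rV[R]_a -> set 'rV[R]_b)
  (v : set 'rV[R]_c -> set 'rV[R]_d) (F : set 'rV[R]_(a + c)) :=
  setprod (u (lsubmx @` F)) (v (rsubmx @` F)).
have prE a b c d (u : set 'rV[R]_a -> set 'rV[R]_b)
    (v : set 'rV[R]_c -> set 'rV[R]_d) A B : A !=set0 -> B !=set0 ->
  pr _ _ _ _ u v (setprod A B) = setprod (u A) (v B).
  by move=> A0 B0; rewrite /pr setprodKl // setprodKr.
apply/comb_equivP; exists (pr _ _ _ _ f h), (pr _ _ _ _ g k); split.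
- move=> F /face_setprod[A [B [PA QB ->]]].
  have [[PfA gfA] [QhB khB]] := (fK _ PA, hK _ QB).
  rewrite prE; [|exact: PA.1|exact: QB.1].
  rewrite prE ?gfA ?khB; [|exact: PfA.1|exact: QhB.1].
  by split=> //; apply/face_setprod; exists (f A), (h B).
- move=> F /face_setprod[A [B [PA QB ->]]].
  have [[PfA gfA] [QhB khB]] := (gK _ PA, kK _ QB).
  rewrite prE; [|exact: PA.1|exact: QB.1].
  rewrite prE ?gfA ?khB; [|exact: PfA.1|exact: QhB.1].
  by split=> //; apply/face_setprod; exists (g A), (k B).
- move=> F F' /face_setprod[A [B [PA QB ->]]] /face_setprod[A' [B' [PA' QB' ->]]] FF'.
  rewrite !prE; try by [exact: PA.1|exact: QB.1|exact: PA'.1|exact: QB'.1].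
  apply: setprod_sub; [apply: fle | apply: hle] => //.
    rewrite -(setprodKl A QB.1) -(setprodKl A' QB'.1); exact: image_subset.
  rewrite -(setprodKr B PA.1) -(setprodKr B' PA'.1); exact: image_subset.
- move=> F F' /face_setprod[A [B [PA QB ->]]] /face_setprod[A' [B' [PA' QB' ->]]] FF'.
  rewrite !prE; try by [exact: PA.1|exact: QB.1|exact: PA'.1|exact: QB'.1].
  apply: setprod_sub; [apply: gle | apply: kle] => //.
    rewrite -(setprodKl A QB.1) -(setprodKl A' QB'.1); exact: image_subset.
  rewrite -(setprodKr B PA.1) -(setprodKr B' PA'.1); exact: image_subset.
Qed.

Lemma setprodA n m p (P : set 'rV[R]_n) (Q : set 'rV[R]_m) (S : set 'rV[R]_p) :
  comb_equiv (setprod P (setprod Q S)) (setprod (setprod P Q) S).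
Proof.
apply: (@comb_equiv_iso _ _ _ _
  (fun x => row_mx (row_mx (lsubmx x) (lsubmx (rsubmx x))) (rsubmx (rsubmx x)))
  (fun y => row_mx (lsubmx (lsubmx y)) (row_mx (rsubmx (lsubmx y)) (rsubmx y)))).
- move=> x [Px [Qx Sx]]; rewrite /setprod /= !(row_mxKl, row_mxKr); split=> //.
  by rewrite !hsubmxK.
- move=> x [[Px Qx] Sx]; rewrite /setprod /= !(row_mxKl, row_mxKr); split=> //.
  by rewrite !hsubmxK.
- move=> c; exists (col_mx (usubmx (usubmx c)) (col_mx (dsubmx (usubmx c)) (dsubmx c))).
  move=> x; rewrite -{1}(vsubmxK c) -{1}(vsubmxK (usubmx c)) !dot_col_mx.
  by rewrite !(row_mxKl, row_mxKr) addrA.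
- move=> c; exists (col_mx (col_mx (usubmx c) (usubmx (dsubmx c))) (dsubmx (dsubmx c))).
  move=> x; rewrite -{1}(vsubmxK c) -{1}(vsubmxK (dsubmx c)) !dot_col_mx.
  by rewrite !(row_mxKl, row_mxKr) addrA.
Qed.

Lemma setprodC n m (P : set 'rV[R]_n) (Q : set 'rV[R]_m) :
  comb_equiv (setprod P Q) (setprod Q P).
Proof.
have swapl k l (c : 'cV[R]_(k + l)) : exists d : 'cV[R]_(l + k), forall x,
  dot c (row_mx (rsubmx x) (lsubmx x)) = dot d x.
  exists (col_mx (dsubmx c) (usubmx c)) => x.
  by rewrite -{1}(vsubmxK c) !dot_col_mx row_mxKl row_mxKr addrC.
apply: (@comb_equiv_iso _ _ _ _ (fun x => row_mx (rsubmx x) (lsubmx x))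
  (fun x => row_mx (rsubmx x) (lsubmx x))) => //;
  by move=> x [? ?]; rewrite /setprod /= !(row_mxKl, row_mxKr) hsubmxK.
Qed.

Fact point_subproof : is_polytope [set: 'rV[R]_0].
Proof.
split; first by exists 0.
- by exists 0 => x _ [].
- by exists [::]; apply/seteqP; split=> // x _ h.
Qed.

Definition point_polytope : polytope 0 := Polytope point_subproof.

Lemma setprod_point n (P : set 'rV[R]_n) : comb_equiv (setprod point_polytope P) P.
Proof.
apply: (@comb_equiv_iso _ _ _ _ (fun x : 'rV[R]_(0 + n) => rsubmx x)
  (fun y => row_mx (0 : 'rV[R]_0) y)).
- by move=> x [_ Px]; split=> //; rewrite -[RHS]hsubmxK; congr row_mx;
    apply/rowP => -[].
- by move=> y Py; rewrite row_mxKr; split=> //; apply/setprod_row.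
- by move=> c; exists (col_mx 0 c) => x; rewrite dot_col_mx dot0 add0r.
- move=> d; exists (dsubmx d) => y.
  by rewrite -{1}(vsubmxK d) dot_col_mx row_mxKl row_mxKr /dot mul0mx mxE add0r.
Qed.

Lemma comb_equiv_point n (P : set 'rV[R]_n) :
  comb_equiv P point_polytope <->
  exists2 F, is_face P F & forall F', is_face P F' -> F' = F.
Proof.
have ptE F : is_face point_polytope F -> F = [set: 'rV[R]_0].
  move=> [[x Fx] _]; apply/seteqP; split=> // y _.
  by have -> : y = x by apply/rowP => -[].
split=> [/comb_equivP[f [g [fK gK _ _]]]|[F PF Funiq]].
  exists (g [set: 'rV[R]_0]); first by case: (gK _ (face_self point_polytope)).
  by move=> F /fK[/ptE <- ->].
apply/comb_equivP; exists (fun=> setT), (fun=> F); split.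
- by move=> F' PF'; split; [exact: (face_self point_polytope)|rewrite (Funiq F')].
- by move=> G /ptE ->; split.
- by move=> ? ? _ _ _ ?.
- by move=> ? ? _ _ _ ?.
Qed.

Lemma comb_equiv_setprod_point n m (P : polytope n) (Q : polytope m) :
  comb_equiv (setprod P Q) point_polytope -> comb_equiv P point_polytope.
Proof.
move=> /comb_equiv_point[F /face_setprod[A [B [PA QB FE]]] Funiq].
apply/comb_equiv_point; exists A => // A' PA'.
have /Funiq FE' : is_face (setprod P Q) (setprod A' B).
  by apply/face_setprod; exists A', B.
by rewrite -(setprodKl A' QB.1) FE' FE (setprodKl A QB.1).
Qed.

Definition any_polytope := {n : nat & polytope n}.
HB.instance Definition _ := Choice.on any_polytope.

Definition any_equiv (P Q : any_polytope) : bool :=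
  `[< comb_equiv (projT2 P) (projT2 Q) >].

Fact any_equiv_refl : reflexive any_equiv.
Proof. by move=> P; apply/asboolP; exact: comb_equiv_refl. Qed.
Fact any_equiv_sym : symmetric any_equiv.
Proof. by move=> P Q; apply/asboolP/asboolP; exact: comb_equiv_sym. Qed.
Fact any_equiv_trans : transitive any_equiv.
Proof.
by move=> Q P S /asboolP PQ /asboolP QS; apply/asboolP; exact: comb_equiv_trans QS.
Qed.

Canonical any_equiv_rel :=
  EquivRel any_equiv any_equiv_refl any_equiv_sym any_equiv_trans.

Definition comb_type := {eq_quot any_equiv_rel}%qT.
HB.instance Definition _ := Choice.on comb_type.

Definition comb_class n (P : polytope n) : comb_type :=
  \pi_comb_type%qT (existT _ n P : any_polytope).

Lemma eq_class n m (P : polytope n) (Q : polytope m) :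
  comb_class P = comb_class Q <-> comb_equiv P Q.
Proof.
split=> [/eqmodP /asboolP //|PQ].
by apply/eqmodP; apply/asboolP.
Qed.

Lemma classP (a : comb_type) : exists n (P : polytope n), a = comb_class P.
Proof.
exists (projT1 (repr a)), (projT2 (repr a)); rewrite /comb_class -[LHS]reprK.
by case: (repr a).
Qed.

Definition comb_one : comb_type := comb_class point_polytope.
Definition comb_mul (a b : comb_type) : comb_type :=
  comb_class (polytope_prod (projT2 (repr a)) (projT2 (repr b))).

Lemma class_prod n m (P : polytope n) (Q : polytope m) :
  comb_class (polytope_prod P Q) = comb_mul (comb_class P) (comb_class Q).
Proof.
have reprE k (S : polytope k) : comb_equiv S (projT2 (repr (comb_class S))).
  apply/eq_class; rewrite {1}[comb_class S](esym (reprK _)) /comb_class.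
  by case: (repr _).
by apply/eq_class; apply: comb_equiv_setprod; exact: reprE.
Qed.

Fact comb_mulA : associative comb_mul.
Proof.
move=> a b c; have [n [P ->]] := classP a; have [m [Q ->]] := classP b.
have [p [S ->]] := classP c; rewrite -!class_prod; apply/eq_class.
exact: setprodA.
Qed.
Fact comb_mulC : commutative comb_mul.
Proof.
move=> a b; have [n [P ->]] := classP a; have [m [Q ->]] := classP b.
rewrite -!class_prod; apply/eq_class; exact: setprodC.
Qed.
Fact comb_mul1 : left_id comb_one comb_mul.
Proof.
move=> a; have [n [P ->]] := classP a.
rewrite -class_prod; apply/eq_class; exact: setprod_point.
Qed.
Fact comb_mulr1 : right_id comb_one comb_mul.
Proof. by move=> a; rewrite comb_mulC comb_mul1. Qed.
Fact comb_unit a b : comb_mul a b = comb_one -> a = comb_one /\ b = comb_one.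
Proof.
have main c d : comb_mul c d = comb_one -> c = comb_one.
  have [n [P ->]] := classP c; have [m [Q ->]] := classP d.
  by rewrite -class_prod => /eq_class /comb_equiv_setprod_point /eq_class.
by move=> ab; split; [exact: main ab | apply: main; rewrite comb_mulC; exact: ab].
Qed.

HB.instance Definition _ := Choice_isMonomialDef.Build comb_type
  comb_mulA comb_mul1 comb_mulr1 comb_unit.
HB.instance Definition _ := MonomialDef_isConomialDef.Build comb_type comb_mulC.

(* $\mathfrak P$ is the monoid ring of the monoid of classes under Cartesian
   product. Being free over [comb_type], its tensor product with the rationals
   is the rational algebra on the same basis. *)
Definition polytope_ring := {malg int[comb_type]}.
Definition polytope_ringQ := {malg rat[comb_type]}.

(* The map x |-> x (x) 1. *)
Definition toQ (p : polytope_ring) : polytope_ringQ :=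
  mmap (fun z : int => z%:~R : polytope_ringQ)
       (fun k : comb_type => << k >> : polytope_ringQ) p.

Definition poly_class n (P : polytope n) : polytope_ring := << comb_class P >>.

Lemma poly_class_prod n m (P : polytope n) (Q : polytope m) :
  poly_class (polytope_prod P Q) = poly_class P * poly_class Q.
Proof. by rewrite /poly_class class_prod malgM_def fgmulUU mulr1. Qed.

Lemma mcoeff_toQ p k : (toQ p)@_k = (p@_k)%:~R.
Proof.
rewrite /toQ mmapE raddf_sum [in RHS](monalgE p) !raddf_sum /=.
apply: eq_bigr => j _; rewrite mcoeffU mulrzl raddfMz /= mcoeffU1.
by case: eqVneq => _; rewrite ?mul0rz ?mulr0n ?mulr0z ?mulr1n.
Qed.

(* [finite_faces] makes this a finite sum. *)
Definition motivic_interior n (Q : polytope n) : polytope_ring :=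
  \sum_(F \in faces Q) (-1) ^+ codim Q F * poly_class F.

End Polytopes.

Definition induced_connected n (e : rel 'I_n) (S : {set 'I_n}) : Prop :=
  forall x y, x \in S -> y \in S ->
    connect [rel a b | [&& a \in S, b \in S & e a b]] x y.

Record connected_graph n := ConnectedGraph {
  adj :> rel 'I_n;
  adj_sym : symmetric adj;
  adj_irr : irreflexive adj;
  adj_conn : induced_connected adj [set: 'I_n]%SET }.

Section GraphAssociahedra.
Variable R : realType.

Definition graph_assoc_set n (G : connected_graph n) : set 'rV[R]_n :=
  [set x | \sum_i x 0 i = 3 ^+ n /\
           forall S : {set 'I_n}, S != finset.set0 -> S \proper [set: 'I_n]%SET ->
             induced_connected G S -> 3 ^+ #|S| <= \sum_(i in S) x 0 i].

Let chi n (S : {set 'I_n}) : 'cV[R]_n := \col_i (i \in S)%:R.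

Let dot_chi n (S : {set 'I_n}) x : dot (chi S) x = \sum_(i in S) x 0 i.
Proof.
rewrite /dot mxE [RHS]big_mkcond /=; apply: eq_bigr => i _.
by rewrite mxE; case: (i \in S); rewrite ?mulr1 ?mulr0.
Qed.

Lemma graph_assoc_polytope n (G : connected_graph n.+1) :
  is_polytope (graph_assoc_set G).
Proof.
split.
- pose N := n.+1; have N0 : 0 < N%:R :> R by rewrite ltr0n.
  exists (const_mx (3 ^+ N / N%:R)); split.
    under eq_bigr do rewrite mxE.
    by rewrite sumr_const card_ord -[LHS]mulr_natr divfK // gt_eqF.
  move=> S S0 _ _; under eq_bigr do rewrite mxE.
  rewrite sumr_const -[leRHS]mulr_natr mulrAC ler_pdivlMr // -!natrX -!natrM ler_nat.
  have sN : (#|S| <= N)%N by rewrite -[leqRHS]card_ord max_card.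
  have s0 : (0 < #|S|)%N by rewrite card_gt0.
  rewrite -(subnK sN); elim: (N - #|S|)%N => [|d IH]; first by rewrite add0n.
  rewrite addSn expnS -mulnA; apply: leq_trans (leq_mul (leqnn 3) IH).
  by rewrite mulnCA leq_mul2l; apply/orP; right; lia.
- exists (3 ^+ n.+1) => x [xs xS] i.
  have x0 k : 0 <= x 0 k.
    have [kp|knp] := boolP ([set k]%SET \proper [set: 'I_n.+1]%SET).
      have := xS [set k]%SET; rewrite -card_gt0 cards1 big_set1.
      move=> /(_ isT kp) H; apply: le_trans (H _); first by rewrite exprn_ge0.
      by move=> a b /set1P-> /set1P->; exact: connect0.
    have kT : [set k]%SET = [set: 'I_n.+1]%SET.
      by apply/eqP; rewrite finset.eqEproper finset.subsetT.
    suff -> : x 0 k = 3 ^+ n.+1 by rewrite exprn_ge0.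
    transitivity (\sum_(j in [set k]%SET) x 0 j); first by rewrite big_set1.
    rewrite -xs kT.
    by apply: eq_bigl => j; rewrite inE.
  rewrite ger0_norm // -xs (bigD1 i) //= lerDl sumr_ge0 // => k _; exact: x0.
pose fam := map (fun S : {set 'I_n.+1} => (- chi S, - 3 ^+ #|S| : R)) (enum
  [pred S : {set 'I_n.+1} | [&& S != finset.set0,
    S \proper [set: 'I_n.+1]%SET & `[< induced_connected G S >]]]).
exists ((chi [set: 'I_n.+1]%SET, 3 ^+ n.+1) ::
        (- chi [set: 'I_n.+1]%SET, - 3 ^+ n.+1) :: fam).
have sumT (x : 'rV[R]_n.+1) : \sum_(i in [set: 'I_n.+1]%SET) x 0 i = \sum_i x 0 i.
  by apply: eq_bigl => j; rewrite inE.
apply/seteqP; split=> [x [xs xS] h|x H].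
  rewrite !inE => /or3P[/eqP->|/eqP->|/mapP[S]] /=.
  - by rewrite dot_chi sumT xs.
  - by rewrite dotN dot_chi sumT xs.
  rewrite mem_enum inE => /and3P[S0 Sp /asboolP Sc] -> /=.
  by rewrite dotN dot_chi lerN2; exact: xS.
split.
  apply/eqP; rewrite eq_le.
  have := H _ (mem_head _ _); rewrite /= dot_chi sumT => ->.
  have := H (- chi [set: 'I_n.+1]%SET, - 3 ^+ n.+1).
  by rewrite !inE eqxx orbT => /(_ isT) /=; rewrite dotN dot_chi sumT lerN2.
move=> S S0 Sp Sc; have := H (- chi S, - 3 ^+ #|S|).
rewrite !inE [_ \in fam]map_f ?orbT /=.
  by move=> /(_ isT); rewrite dotN dot_chi lerN2.
by rewrite mem_enum inE S0 Sp; apply/asboolP.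
Qed.

Definition graph_assoc n (G : connected_graph n.+1) : polytope R n.+1 :=
  Polytope (graph_assoc_polytope G).

End GraphAssociahedra.

Definition star_rel n : rel 'I_n.+1 :=
  fun i j => (i != j) && ((i == ord0) || (j == ord0)).

Fact star_sym n : symmetric (@star_rel n).
Proof. by move=> i j; rewrite /star_rel eq_sym orbC. Qed.
Fact star_irr n : irreflexive (@star_rel n).
Proof. by move=> i; rewrite /star_rel eqxx. Qed.
Fact star_conn n : induced_connected (@star_rel n) [set: 'I_n.+1]%SET.
Proof.
move=> x y _ _; apply: (@connect_trans _ _ ord0).
  have [->|x0] := eqVneq x ord0; first exact: connect0.
  by apply: connect1; rewrite /= !inE /star_rel x0 eqxx orbT.
have [->|y0] := eqVneq y ord0; first exact: connect0.
by apply: connect1; rewrite /= !inE /star_rel eq_sym y0 eqxx.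
Qed.

(* The star with n + 1 vertices, [ord0] being the centre. *)
Definition star_graph n : connected_graph n.+1 :=
  ConnectedGraph (@star_sym n) (@star_irr n) (@star_conn n).

Fact complete_sym n : symmetric (fun i j : 'I_n => i != j).
Proof. by move=> i j; rewrite eq_sym. Qed.
Fact complete_irr n : irreflexive (fun i j : 'I_n => i != j).
Proof. by move=> i; rewrite eqxx. Qed.
Fact complete_conn n :
  induced_connected (fun i j : 'I_n => i != j) [set: 'I_n]%SET.
Proof.
move=> x y _ _; have [->|xy] := eqVneq x y; first exact: connect0.
by apply: connect1; rewrite /= !inE.
Qed.

Definition complete_graph n : connected_graph n :=
  ConnectedGraph (@complete_sym n) (@complete_irr n) (@complete_conn n).

Section Series.
Variable R : realType.

(* [stellohedron n] and [permutohedron n] are S_(n+1) and $\pi_{n+1}$. *)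
Definition stellohedron n : polytope R n.+1 := graph_assoc R (star_graph n).
Definition permutohedron n : polytope R n.+1 :=
  graph_assoc R (complete_graph n.+1).

Definition egf (a : nat -> polytope_ringQ R) : fps (polytope_ringQ R) :=
  Fps (fun n => (n`!%:R : rat)^-1 *: a n).

Definition exp_Nx : fps (polytope_ringQ R) := egf (fun n => (-1) ^+ n).

Definition S_series : fps (polytope_ringQ R) :=
  egf (fun n => toQ (poly_class (stellohedron n))).

Definition So_series : fps (polytope_ringQ R) :=
  egf (fun n => toQ (motivic_interior (stellohedron n))).

Definition Pi_series : fps (polytope_ringQ R) :=
  egf (fun n => if n is m.+1 then toQ (poly_class (permutohedron m)) else 1).

Definition Pio_series : fps (polytope_ringQ R) :=
  egf (fun n => if n is m.+1 then - toQ (motivic_interior (permutohedron m))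
                else 1).

Lemma Pi_series_unit : Pi_series \is a GRing.unit.
Proof. by apply: fps_unit1; rewrite /= fact0 invr1 scale1r. Qed.

End Series.

(* Main.v *)
Require Import Defs.
From HB Require Import structures.
From mathcomp Require Import boolp classical_sets fsbigop.
From mathcomp Require Import reals monalg.
From mathcomp Require Import all_boot all_order all_algebra.
From mathcomp Require Import lra zify.

(** Complete graphs and stars are both obtained from a vertex set V with an
   independent set L of leaves by drawing all the other edges (L is empty for
   the complete graph). A proper nonempty S is then a tube unless it is a set
   of at least two leaves. Because 3^|S| grows so fast, the tight tubes of a
   point of the graph-associahedron are pairwise nested or both single leaves,
   and every such nested set N is the exact tight set of some point. So the
   faces are the F_N, ordered by reverse inclusion of N, and F_N has
   codimension |N|.

   A nested set either consists of leaves only, or has a largest tube C. In the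
   second case restriction to C and contraction of C identify the face poset of
   F_N with that of a product of a face of the associahedron of C and a
   permutohedron; contracting a set of leaves of a star gives a smaller star.
   Summing over N according to C yields
     S°(x) Π(x) = e^{-x} S(x)   and   Π°(x) Π(x) = 1. *)

Set Implicit Arguments.
Unset Strict Implicit.
Unset Printing Implicit Defensive.

Import Order.TTheory GRing.Theory Num.Theory.

(** * Nested sets *)

Section Nested.
Variables (V : finType) (L : {set V}).
Implicit Types (S T U C : {set V}) (N M : {set {set V}}).

Definition tube S :=
  [&& S != set0, S != setT & ~~ (S \subset L) || (#|S| == 1)].

(** In general two disjoint tubes may coexist if no edge joins them. Here a vertex outside [L] is
    adjacent to every other vertex, so this can only happen for two leaves. *)
Definition compat S T := [|| S \subset T, T \subset S | (S \subset L) && (T \subset L)].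

Definition nested N :=
  [forall S in N, tube S] && [forall S in N, forall T in N, compat S T].

Lemma nestedP N :
  reflect ({in N, forall S, tube S} /\ {in N &, forall S T, compat S T}) (nested N).
Proof.
apply: (iffP andP) => -[tN cN]; split.
- by move=> S SN; exact: (forall_inP tN).
- by move=> S T SN TN; exact: (forall_inP (forall_inP cN S SN)).
- exact/forall_inP.
- by apply/forall_inP => S SN; apply/forall_inP => T TN; exact: cN.
Qed.

Lemma compatC S T : compat S T = compat T S.
Proof. by rewrite /compat orbCA [(S \subset L) && _]andbC. Qed.

Lemma nested0 : nested set0.
Proof. by apply/nestedP; split=> S; rewrite inE. Qed.

Lemma nestedS N M : M \subset N -> nested N -> nested M.
Proof.
move=> /subsetP MN /nestedP[tN cN]; apply/nestedP; split=> [S /MN /tN //|S T].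
by move=> /MN SN /MN TN; exact: cN.
Qed.

Lemma tube_leaf S : tube S -> S \subset L -> exists2 i, i \in L & S = [set i].
Proof.
move=> /and3P[_ _ /orP[/negP //|/cards1P[i ->]]] iL; exists i => //.
by rewrite -sub1set.
Qed.

(** Take for [C] a member of largest size among those not inside [L]. Any other member is comparable
    with [C], because the clause of [compat] about leaves fails for [C], and a member containing [C]
    equals it by maximality. *)
Lemma nested_top N : nested N -> {in N, forall S, S \subset L} \/
  exists C, [/\ C \in N, ~~ (C \subset L) & {in N, forall S, S \subset C}].
Proof.
move=> /nestedP[tN cN].
have [/forall_inP NL|] := boolP [forall S in N, S \subset L]; first by left.
rewrite negb_forall_in => /exists_inP[C0 C0N C0L]; right.
have P0 : (C0 \in N) && ~~ (C0 \subset L) by rewrite C0N.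
case: (@arg_maxnP _ C0 [pred S | (S \in N) && ~~ (S \subset L)] (fun S => #|S|) P0).
move=> C /= /andP[CN CL] Cmax; exists C; split=> // S SN.
have /or3P[//|CS|/andP[_ CL']] := cN _ _ SN CN; last by rewrite CL' in CL.
have SL : ~~ (S \subset L) by apply: contra CL; exact: subset_trans.
have := Cmax S; rewrite SN SL => /(_ isT) SC.
by rewrite (_ : C = S) //; apply/eqP; rewrite eqEcard CS.
Qed.

Lemma nested_setU N M : nested N -> nested M ->
  (forall S T, S \in N -> T \in M -> compat S T) -> nested (N :|: M).
Proof.
move=> /nestedP[tN cN] /nestedP[tM cM] cNM; apply/nestedP; split.
  by move=> S; rewrite inE => /orP[/tN|/tM].
move=> S T; rewrite !inE => /orP[] SN /orP[] TN.
- exact: cN.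
- exact: cNM.
- by rewrite compatC cNM.
- exact: cM.
Qed.

End Nested.

Definition leaves (V : finType) (A : {set V}) : {set {set V}} :=
  [set [set i] | i in A].

Lemma mem_leaves (V : finType) (A : {set V}) i : ([set i] \in leaves A) = (i \in A).
Proof. by rewrite /leaves mem_imset //; exact: set1_inj. Qed.

Lemma card_leaves (V : finType) (A : {set V}) : #|leaves A| = #|A|.
Proof. by rewrite card_imset //; exact: set1_inj. Qed.

Lemma set1_neqT (V : finType) (L : {set V}) i : L != setT -> i \in L -> [set i] != setT.
Proof.
by move=> LT iL; apply: contraNneq LT => iT; rewrite -subTset -iT sub1set.
Qed.

Lemma nested_leaves (V : finType) (L A : {set V}) : L != setT -> A \subset L ->
  nested L (leaves A).
Proof.
move=> LT /subsetP AL; apply/nestedP; split=> [_ /imsetP[i iA ->]|].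
  by rewrite /tube cards1 eqxx orbT andbT -card_gt0 cards1 (set1_neqT LT) ?AL.
move=> _ _ /imsetP[i iA ->] /imsetP[j jA ->].
by rewrite /compat !sub1set !AL // !orbT.
Qed.

(** * Restriction of nested sets to a tube *)

Section Relabel.
Variables (W V : finType) (f : W -> V) (L : {set V}).
Hypothesis f_inj : injective f.
Let C := f @: setT.
Hypothesis CL : ~~ (C \subset L).

Lemma preim_sub (S : {set V}) : S \subset C -> f @: (f @^-1: S) = S.
Proof.
move=> /subsetP SC; apply/setP => v; apply/imsetP/idP => [[w]|vS].
  by rewrite inE => wS ->.
by have /imsetP[w _ vE] := SC _ vS; exists w; rewrite // inE -vE.
Qed.

Lemma imset_subE (S T : {set W}) : (f @: S \subset f @: T) = (S \subset T).
Proof.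
apply/idP/idP => [/subsetP ST|]; last exact: imsetS.
by apply/subsetP => w wS; rewrite -(mem_imset _ _ f_inj) ST // imset_f.
Qed.

Lemma imset_subL (S : {set W}) : (f @: S \subset L) = (S \subset f @^-1: L).
Proof.
by apply/subsetP/subsetP => SL w wS; [rewrite inE SL // imset_f |
  case/imsetP: wS => u /SL; rewrite inE => ? ->].
Qed.

Lemma imset_tube (S : {set W}) : tube (f @^-1: L) S ->
  tube L (f @: S) /\ f @: S \proper C.
Proof.
move=> /and3P[S0 ST SL].
have SC : f @: S \proper C.
  by rewrite properE imset_subE subsetT imset_subE subTset.
split=> //; rewrite /tube card_imset // imset_subL SL andbT imset_eq0 S0 /=.
by apply: contraTneq SC => ->; rewrite properE subsetT andbF.
Qed.

Lemma preim_tube (S : {set V}) : tube L S -> S \proper C -> tube (f @^-1: L) (f @^-1: S).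
Proof.
move=> /and3P[S0 ST SL] /properP[SC [v vC vS]].
have SE := preim_sub SC.
rewrite /tube -(imset_eq0 f) -imset_subL -(card_imset _ f_inj) SE S0 SL andbT /=.
apply: contraNneq vS => ST'; rewrite -(preim_sub SC) ST'.
by case/imsetP: vC => w _ ->; rewrite imset_f.
Qed.

Lemma imset_compat (S T : {set W}) :
  compat L (f @: S) (f @: T) = compat (f @^-1: L) S T.
Proof. by rewrite /compat !imset_subE !imset_subL. Qed.

(** Nested sets of the restriction become those with largest tube [C]. The set [C] is added by hand
    because the full set [setT] of [W], whose image it is, is not a tube. *)
Definition relabel (M : {set {set W}}) : {set {set V}} := C |: [set f @: (S : {set W}) | S in M].

Lemma in_relabel M S :
  (S \in relabel M) = (S == C) || (S \in [set f @: (S : {set W}) | S in M]).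
Proof. by rewrite in_setU1. Qed.

Lemma relabel_sub M S : S \in relabel M -> S \subset C.
Proof.
by rewrite in_relabel => /orP[/eqP-> //|/imsetP[T _ ->]]; exact: imsetS (subsetT _).
Qed.

Lemma nested_relabel M : C != setT -> nested (f @^-1: L) M -> nested L (relabel M).
Proof.
move=> CT /nestedP[tM cM].
have tC : tube L C.
  rewrite /tube CL CT /= andbT; apply: contraNneq CL => ->; exact: sub0set.
have cC S : S \in relabel M -> compat L S C.
  by move=> /relabel_sub SC; rewrite /compat SC.
apply/nestedP; split=> [S|S T SM TM].
  by rewrite in_relabel => /orP[/eqP-> //|/imsetP[T /tM /imset_tube[? _] ->]].
move: (SM); rewrite in_relabel => /orP[/eqP->|]; first by rewrite compatC cC.
move: (TM); rewrite in_relabel => /orP[/eqP->|]; first by rewrite cC.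
by move=> /imsetP[T' TM' ->] /imsetP[S' SM' ->]; rewrite imset_compat cM.
Qed.

Lemma relabel_onto N : nested L N -> C \in N -> {in N, forall S : {set V}, S \subset C} ->
  exists2 M, nested (f @^-1: L) M & N = relabel M.
Proof.
(* [C] is removed first: its preimage is the full set, while the other members are proper in [C] and
   pull back to tubes. *)
move=> /nestedP[tN cN] CN NC; exists [set f @^-1: (S : {set V}) | S in N :\ C].
  have pN S : S \in N :\ C -> S \proper C.
    by rewrite in_setD1 => /andP[SC /NC]; rewrite properEneq SC.
  have sN S : S \in N :\ C -> S \in N by rewrite in_setD1 => /andP[].
  apply/nestedP; split=> [_ /imsetP[S SN ->]|].
    by apply: preim_tube; [apply/tN/sN | exact: pN].
  move=> _ _ /imsetP[S SN ->] /imsetP[T TN ->].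
  by rewrite -imset_compat !preim_sub ?NC ?cN ?sN.
rewrite -{1}(setD1K CN); congr (_ |: _); rewrite -imset_comp.
rewrite -{1}[N :\ C]imset_id; apply: eq_in_imset => S; rewrite in_setD1 => /andP[_ /NC SC].
by rewrite /= preim_sub.
Qed.

Lemma imset_imset_sub (M K : {set {set W}}) :
  ([set f @: (S : {set W}) | S in M] \subset [set f @: (S : {set W}) | S in K]) = (M \subset K).
Proof.
have F : injective (fun S : {set W} => f @: S) by exact: imset_inj.
apply/idP/idP => [/subsetP MK|]; last exact: imsetS.
by apply/subsetP => w wS; rewrite -(mem_imset _ _ F) MK // imset_f.
Qed.

Lemma relabel_notin M : nested (f @^-1: L) M -> C \notin [set f @: (S : {set W}) | S in M].
Proof.
move=> /nestedP[tM _]; apply/imsetP => -[S /tM /imset_tube[_]] /[swap] <-.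
by rewrite properxx.
Qed.

Lemma relabel_subE M K : nested (f @^-1: L) M -> nested (f @^-1: L) K ->
  (relabel M \subset relabel K) = (M \subset K).
Proof.
move=> nM nK; rewrite -[RHS]imset_imset_sub; apply/idP/idP; last exact: setUS.
rewrite /relabel subUset => /andP[_] /subsetP MK; apply/subsetP => S SM.
have := MK _ SM; rewrite in_relabel => /orP[/eqP SC|//].
by have := relabel_notin nM; rewrite -SC SM.
Qed.

Lemma card_relabel M : nested (f @^-1: L) M -> #|relabel M| = #|M|.+1.
Proof.
move=> nM; rewrite /relabel cardsU1 relabel_notin // card_imset //.
exact: imset_inj.
Qed.

End Relabel.

(** * Contraction of a tube or of a set of leaves *)

Section Contract.
Variables (W V : finType) (g : W -> V) (L L0 I : {set V}) (B0 : {set {set V}}).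
Hypothesis g_inj : injective g.
Hypothesis g_codom : g @: setT = ~: I.
Hypothesis LT : L != setT.
(* [I] is either a tube that is not a leaf, whose contraction leaves a complete
   graph, or a set of leaves. *)
Hypothesis contractible :
  [/\ ~~ (I \subset L), I != setT, L0 = set0 & B0 = [set I]] \/
  [/\ I \subset L, L0 = L & B0 = leaves I].

Let L2 := g @^-1: L0.

Implicit Type S : {set W}.

(** Among the tubes that are compatible with [B0] and not inside [I], a leaf misses [I] and any
    other one contains it. This decides whether [I] is put back. *)
Definition uncontract (S : {set W}) : {set V} :=
  g @: S :|: (if S \subset L2 then set0 else I).

Let gI w : g w \notin I.
Proof. by rewrite -in_setC -g_codom imset_f. Qed.

Lemma mem_uncontract w S : (g w \in uncontract S) = (w \in S).
Proof.
rewrite inE mem_imset //; case: ifP => _; first by rewrite inE orbF.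
by rewrite (negPf (gI w)) orbF.
Qed.

Lemma preim_uncontract S : g @^-1: uncontract S = S.
Proof. by apply/setP => w; rewrite inE mem_uncontract. Qed.

Lemma uncontract_inj : injective uncontract.
Proof. by move=> S T ST; rewrite -(preim_uncontract S) ST preim_uncontract. Qed.

Lemma uncontract_subE S (T : {set W}) : (uncontract S \subset uncontract T) = (S \subset T).
Proof.
apply/idP/idP => [/subsetP ST|ST].
  by apply/subsetP => w wS; rewrite -mem_uncontract ST // mem_uncontract.
apply: setUSS; first exact: imsetS.
case: ifP => SL; first exact: sub0set.
case: ifP => // TL; by rewrite (subset_trans ST TL) in SL.
Qed.

Let L0L : L0 \subset L.
Proof. by case: contractible => [[_ _ -> _]|[_ -> _]]; rewrite ?sub0set. Qed.

Lemma uncontract_notin S : S != set0 -> ~~ (uncontract S \subset I).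
Proof.
move=> /set0Pn[w wS]; apply: contra (gI w) => /subsetP; apply.
by rewrite mem_uncontract.
Qed.

Let sub_notL S : S != set0 -> ~~ (S \subset L2) -> ~~ (uncontract S \subset L).
Proof.
move=> S0 SL; case: contractible => [[IL _ _ _]|[_ L0E _]].
  by apply: contra IL; apply: subset_trans; rewrite /uncontract (negPf SL) subsetUr.
apply: contra SL => /subsetP SL; apply/subsetP => w wS.
by rewrite inE L0E SL // mem_uncontract.
Qed.

Lemma uncontract_subL S : S != set0 -> (uncontract S \subset L) = (S \subset L2).
Proof.
move=> S0; have [SL|SL] := boolP (S \subset L2); last exact/negbTE/sub_notL.
rewrite /uncontract SL setU0; apply: subset_trans L0L.
by apply/subsetP => _ /imsetP[w wS ->]; have := subsetP SL w wS; rewrite inE.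
Qed.

Lemma uncontract_tube S : tube L2 S -> tube L (uncontract S).
Proof.
move=> /and3P[S0 ST S1]; apply/and3P; split.
- by apply: contraNneq (uncontract_notin S0) => ->; exact: sub0set.
- by apply: contraNneq ST => ST; rewrite -(preim_uncontract S) ST preimsetT.
rewrite uncontract_subL //; case: (boolP (S \subset L2)) S1 => //= SL.
by rewrite /uncontract SL setU0 card_imset.
Qed.

Lemma uncontract_compat S (T : {set W}) : S != set0 -> T != set0 ->
  compat L (uncontract S) (uncontract T) = compat L2 S T.
Proof. by move=> S0 T0; rewrite /compat !uncontract_subE !uncontract_subL. Qed.

(** A lift either contains [I], hence [T], or consists of leaves; a nonempty lift of the second kind
    exists only when [I] consists of leaves as well. *)
Lemma uncontract_low S (T : {set V}) : S != set0 -> T \subset I -> compat L (uncontract S) T.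
Proof.
move=> S0 TI; rewrite /compat.
have [SL|SL] := boolP (S \subset L2); last first.
  by rewrite orbC -orbA (subset_trans TI) ?orbT // /uncontract (negPf SL) subsetUr.
rewrite uncontract_subL // SL; case: contractible => [[_ _ L0E _]|[IL _ _]].
  by move: SL; rewrite /L2 L0E preimset0 subset0 (negPf S0).
by rewrite (subset_trans TI IL) !orbT.
Qed.

(** Compatibility with [B0] forces [T] to contain [I] unless [T] is a leaf outside [I]. So [T] is
    determined by its trace on the complement of [I]. *)
Lemma high_tube T : tube L T -> ~~ (T \subset I) ->
  (forall U, U \in B0 -> compat L T U) ->
  tube L2 (g @^-1: T) /\ T = uncontract (g @^-1: T).
Proof.
move=> tT TI TB.
have cI v : v \notin I -> exists w, v = g w.
  by rewrite -in_setC -g_codom => /imsetP[w _ ->]; exists w.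
have [v vT vI] := subsetPn TI.
have [w vE] := cI v vI.
have T0 : g @^-1: T != set0 by apply/set0Pn; exists w; rewrite inE -vE.
have [TL|TL] := boolP (T \subset L0).
  have [i iL TE] := tube_leaf tT (subset_trans TL L0L).
  have {i iL}TE : T = [set g w].
    by move: vT; rewrite TE inE -vE => /eqP ->.
  have wT : g @^-1: T = [set w] by apply/setP => u; rewrite TE !inE inj_eq.
  have wL : w \in L2 by rewrite inE (subsetP TL) // TE inE.
  split; last by rewrite /uncontract wT sub1set wL setU0 imset_set1.
  rewrite wT /tube cards1 orbT andbT -card_gt0 cards1 /=.
  (* If the leaf [w] were the only vertex left after contraction, it would form all of [V] together
     with the leaves in [I], against [LT]. *)
  apply: contraNneq LT => wTT; rewrite -subTset; apply/subsetP => u _.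
  case: contractible TL => [[_ _ -> _]|[IL LE _]].
    by rewrite subset0 => /eqP T0'; move: vT; rewrite T0' inE.
  move=> TL; have [/(subsetP IL) //|uI] := boolP (u \in I).
  rewrite -LE; apply: (subsetP TL); have [x ->] := cI u uI.
  by rewrite TE; have := in_setT x; rewrite -wTT !inE => /eqP ->.
have IT : I \subset T.
  case: contractible TL => [[IL _ _ B0E]|[IL LE B0E]] TL.
    have := TB I; rewrite B0E inE eqxx => /(_ isT).
    by rewrite /compat (negPf TI) (negPf IL) andbF orbF.
  apply/subsetP => i iI; have := TB [set i]; rewrite B0E mem_leaves => /(_ iI).
  rewrite /compat -LE (negPf TL) orbF => /orP[/subsetP Ti|]; last by rewrite sub1set.
  by move: vI; rewrite (set1P (Ti _ vT)) iI.
have T2L : ~~ (g @^-1: T \subset L2).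
  case: contractible TL => [[_ _ L0E _]|[IL LE _]] TL.
    by rewrite /L2 L0E preimset0 subset0.
  have [u uT uL] := subsetPn TL.
  have uI : u \notin I by apply: contra uL => /(subsetP IL); rewrite LE.
  have [x uE] := cI u uI.
  by apply/subsetPn; exists x; rewrite inE -uE.
split.
  apply/and3P; split=> //; last by rewrite T2L.
  move/and3P: tT => [_ TT _]; apply: contraNneq TT => T2T.
  rewrite -subTset; apply/subsetP => u _.
  have [/(subsetP IT) //|uI] := boolP (u \in I).
  have [x ->] := cI u uI.
  by have := in_setT x; rewrite -T2T inE.
apply/setP => u; have [uI|uI] := boolP (u \in I).
  by rewrite (subsetP IT) // /uncontract (negPf T2L) inE uI orbT.
have [x ->] := cI u uI.
by rewrite mem_uncontract inE.
Qed.

Definition join_nested (B : {set {set V}}) (M : {set {set W}}) : {set {set V}} :=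
  B :|: [set uncontract S | S in M].

Lemma nested_join B M : nested L B -> {in B, forall S : {set V}, S \subset I} ->
  nested L2 M -> nested L (join_nested B M).
Proof.
move=> nB BI /nestedP[tM cM].
have M0 S : S \in M -> S != set0 by move=> /tM /and3P[].
apply: nested_setU => //.
  apply/nestedP; split=> [_ /imsetP[S SM ->]|]; first exact/uncontract_tube/tM.
  move=> _ _ /imsetP[S SM ->] /imsetP[T TM ->].
  by rewrite uncontract_compat ?M0 ?cM.
move=> S _ /BI SI /imsetP[T TM ->].
by rewrite compatC uncontract_low // M0.
Qed.

(** The members inside [I] form [B]. The others are lifts by [high_tube], since all of them are
    compatible with the members of [B0]. *)
Lemma join_nested_onto N : nested L N -> B0 \subset N -> exists B M,
  [/\ nested L B, {in B, forall S : {set V}, S \subset I}, B0 \subset B,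
      nested L2 M & N = join_nested B M].
Proof.
move=> nN BN; have [tN cN] := nestedP _ _ nN.
have hi (S : {set V}) : S \in N -> ~~ (S \subset I) ->
    tube L2 (g @^-1: S) /\ S = uncontract (g @^-1: S).
  by move=> SN SI; apply: high_tube (tN _ SN) SI _ => U /(subsetP BN) UN; exact: cN.
exists [set T in N | T \subset I], [set g @^-1: (S : {set V}) | S in N & ~~ (S \subset I)].
split.
- by apply: nestedS nN; apply/subsetP => S; rewrite inE => /andP[].
- by move=> S; rewrite inE => /andP[].
- apply/subsetP => S SB; rewrite inE (subsetP BN) //=.
  case: contractible SB => [[_ _ _ ->]|[_ _ ->]]; first by move=> /set1P ->.
  by move=> /imsetP[i iI ->]; rewrite sub1set.
- apply/nestedP; split=> [_ /imsetP[S SN ->]|_ _ /imsetP[S SN ->] /imsetP[T TN ->]].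
    by move: SN; rewrite inE => /andP[SN SI]; case: (hi _ SN SI).
  move: SN TN; rewrite !inE => /andP[SN SI] /andP[TN TI].
  have [/and3P[S0 _ _] SE] := hi _ SN SI; have [/and3P[T0 _ _] TE] := hi _ TN TI.
  by rewrite -uncontract_compat // -SE -TE cN.
apply/setP => S; rewrite !inE; have [SI|SI] := boolP (S \subset I).
  rewrite andbT; have [//|SN] := boolP (S \in N); apply/esym/imsetP.
  case=> _ /imsetP[T TN ->]; move: TN; rewrite inE => /andP[TN TI].
  by have [_ <-] := hi _ TN TI => SE; rewrite SE TN in SN.
rewrite andbF orFb; apply/idP/imsetP => [SN|[_ /imsetP[T TN ->]]].
  exists (g @^-1: S); last by case: (hi _ SN SI).
  by apply: imset_f; rewrite inE SN.
by move: TN; rewrite inE => /andP[TN TI]; have [_ <-] := hi _ TN TI => ->.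
Qed.

(** No lift of a tube lies inside [I], so the two parts of a join can be told apart and compared
    separately. *)
Lemma join_nested_subE (B B' : {set {set V}}) M M' :
    {in B, forall S : {set V}, S \subset I} -> {in B', forall S : {set V}, S \subset I} ->
    nested L2 M -> nested L2 M' ->
  (join_nested B M \subset join_nested B' M') = (B \subset B') && (M \subset M').
Proof.
move=> BI BI' /nestedP[tM _] /nestedP[tM' _].
have M0 S : S \in M -> S != set0 by move=> /tM /and3P[].
have M0' S : S \in M' -> S != set0 by move=> /tM' /and3P[].
apply/idP/andP => [/subsetP JJ|[BB MM]]; last by apply: setUSS => //; exact: imsetS.
split; apply/subsetP => S SB.
  have := JJ S; rewrite inE SB inE => /(_ isT) /orP[//|/imsetP[T /M0' T0 SE]].
  by have := uncontract_notin T0; rewrite -SE BI.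
have := JJ (uncontract S); rewrite !inE (mem_imset _ _ uncontract_inj) SB orbT => /(_ isT).
rewrite (mem_imset _ _ uncontract_inj) => /orP[/BI'|//].
by rewrite (negPf (uncontract_notin (M0 _ SB))).
Qed.

End Contract.

(** The prescribed image of [ord0] serves to match the centres of stars. It is reached by composing
    an arbitrary enumeration of [C] with the transposition [t] of [ord0] and the index of [c]. *)
Lemma set_bij_ord (V : finType) (C : {set V}) c k : c \in C -> #|C| = k.+1 ->
  exists f : 'I_k.+1 -> V, [/\ injective f, f @: setT = C & f ord0 = c].
Proof.
move=> cC Ck; pose h (i : 'I_k.+1) : V := enum_val (cast_ord (esym Ck) i).
have h_inj : injective h by move=> i j /enum_val_inj /cast_ord_inj.
have hC i : h i \in C by exact: enum_valP.
pose i0 := cast_ord Ck (enum_rank_in cC c).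
have hi0 : h i0 = c by rewrite /h /i0 cast_ordK enum_rankK_in.
pose t i := if i == ord0 then i0 else if i == i0 then ord0 else i.
have tK : involutive t.
  move=> i; rewrite /t; have [->|i_0] := eqVneq i ord0.
    by have [->|_] := eqVneq i0 ord0; rewrite ?eqxx.
  have [->|ii0] := eqVneq i i0; first by rewrite eqxx.
  by rewrite (negPf i_0) (negPf ii0).
have f_inj : injective (h \o t) by apply: inj_comp => //; exact: can_inj tK.
exists (h \o t); split=> //.
apply/eqP; rewrite eqEcard card_imset // cardsT card_ord Ck leqnn andbT.
by apply/subsetP => _ /imsetP[i _ ->]; exact: hC.
Qed.

Local Open Scope ring_scope.

(** * Sums over nested sets, split by the largest tube *)

Section NestedSum.
Variables (A : nmodType) (V : finType) (L : {set V}).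
Hypothesis LT : L != setT.

Lemma sum_nested_leaves (a : {set {set V}} -> A) :
  \sum_(N | nested L N && [forall S in N, S \subset L]) a N =
  \sum_(B : {set V} | B \subset L) a (leaves B).
Proof.
rewrite (reindex_onto (@leaves V) (fun N => [set i | [set i] \in N])) /=.
  apply: eq_bigl => B; apply/andP/idP => [[/andP[_ /forall_inP BL] _]|BL].
    by apply/subsetP => i iB; rewrite -sub1set; apply: BL; rewrite mem_leaves.
  rewrite nested_leaves //=; split.
    apply/forall_inP => _ /imsetP[i iB ->]; rewrite sub1set.
    exact: (subsetP BL).
  by apply/eqP/setP => i; rewrite inE mem_leaves.
move=> N /andP[/nestedP[tN _] /forall_inP NL]; apply/setP => S.
apply/imsetP/idP => [[i]|SN]; first by rewrite inE => ? ->.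
have [i _ SE] := tube_leaf (tN _ SN) (NL _ SN).
by exists i => //; rewrite inE -SE.
Qed.

Lemma sum_nested (a : {set {set V}} -> A) :
  \sum_(N | nested L N) a N =
  \sum_(B : {set V} | B \subset L) a (leaves B) +
  \sum_(C : {set V} | ~~ (C \subset L) && (C != setT))
    \sum_(N | [&& nested L N, C \in N & [forall S in N, S \subset C]]) a N.
Proof.
rewrite (bigID (fun N : {set {set V}} => [forall S in N, S \subset L])) /= sum_nested_leaves.
(* The union of the non-leaf members recovers the largest tube and is defined for every family, so
   it can index a partition of the sum. *)
congr (_ + _); pose top (N : {set {set V}}) := \bigcup_(S in N | ~~ (S \subset L)) S.
have topE (N : {set {set V}}) C : C \in N -> ~~ (C \subset L) -> {in N, forall S : {set V}, S \subset C} ->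
    top N = C.
  move=> CN CL NC; apply/eqP; rewrite eqEsubset bigcup_sup ?CN // andbT.
  by apply/bigcupsP => S /andP[/NC].
rewrite (partition_big top (fun C => ~~ (C \subset L) && (C != setT))) => [|N] /=.
  apply: eq_bigr => C /andP[CL CT]; apply: eq_bigl => N.
  have [nN|//] := boolP (nested L N); rewrite /=.
  apply/andP/andP => [[NL /eqP tC]|[CN /forall_inP NC]].
    have [NL'|[D [DN DL ND]]] := nested_top nN.
      by case/negP: NL; apply/forall_inP.
    have DC : D = C by rewrite -(topE _ _ DN DL ND).
    by rewrite -DC; split=> //; apply/forall_inP.
  split; last by apply/eqP; exact: topE.
  by rewrite negb_forall_in; apply/exists_inP; exists C.
move=> /andP[nN NL]; have [NL'|[D [DN DL ND]]] := nested_top nN.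
  by case/negP: NL; apply/forall_inP.
rewrite (topE _ _ DN DL ND) DL /=.
by have /nestedP[/(_ _ DN) /and3P[]] := nN.
Qed.

Lemma sum_nested_relabel (W : finType) (f : W -> V) (a : {set {set V}} -> A) :
    injective f -> ~~ (f @: setT \subset L) -> f @: setT != setT ->
  \sum_(N | [&& nested L N, f @: setT \in N & [forall S in N, S \subset f @: setT]]) a N =
  \sum_(M | nested (f @^-1: L) M) a (relabel f M).
Proof.
move=> f_inj CL CT.
have inj : {in [pred M | nested (f @^-1: L) M] &, injective (relabel f)}.
  move=> M K nM nK MK; apply/eqP; rewrite eqEsubset.
  by rewrite -(relabel_subE f_inj nM nK) -(relabel_subE f_inj nK nM) MK subxx.
rewrite -(big_imset a inj); apply: eq_bigl => N; apply/and3P/imsetP.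
  move=> [nN CN /forall_inP NC]; have [M nM NE] := relabel_onto f_inj nN CN NC.
  by exists M.
move=> [M nM ->]; split; first exact: nested_relabel.
  by rewrite in_relabel eqxx.
by apply/forall_inP => S; exact: relabel_sub.
Qed.

Lemma sum_subset_card (B : {set V}) (F : nat -> A) :
  \sum_(S : {set V} | S \subset B) F #|S| = \sum_(k < #|B|.+1) F k *+ 'C(#|B|, k).
Proof.
rewrite (partition_big (fun S : {set V} => inord #|S| : 'I_#|B|.+1) xpredT) //=.
apply: eq_bigr => k _; rewrite -cards_draws -sumr_const.
apply: eq_big => [S|S /andP[SB /eqP <-]]; last first.
  by rewrite inordK // ltnS subset_leq_card.
rewrite inE; have [SB /=|//] := boolP (S \subset B).
by rewrite -val_eqE /= inordK // ltnS subset_leq_card.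
Qed.

End NestedSum.

(** * Face posets and dimensions *)

Section FaceParametrization.
Variable R : realType.

(** A description of the face poset by combinatorial data, through which different polytopes are
    compared. Injectivity of [phi] is not imposed: parameters that are [le] each other give the same
    face. *)
Definition faces_param n (P : set 'rV[R]_n) (T : Type) (D : T -> Prop)
    (le : T -> T -> Prop) (phi : T -> set 'rV[R]_n) :=
  [/\ forall t, D t -> is_face P (phi t),
      forall F, is_face P F -> exists2 t, D t & F = phi t &
      forall t u, D t -> D u -> ((phi t `<=` phi u)%classic <-> le t u)].

Lemma comb_equiv_param n m (P : set 'rV[R]_n) (Q : set 'rV[R]_m) T (D : T -> Prop)
    le phi psi :
  faces_param P D le phi -> faces_param Q D le psi -> comb_equiv P Q.
Proof.
move=> [phiF phiS phile] [psiF psiS psile].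
have phi_inj t u : D t -> D u -> phi t = phi u -> psi t = psi u.
  by move=> Dt Du E; apply/seteqP; split; apply/psile/phile; rewrite ?E.
have psi_inj t u : D t -> D u -> psi t = psi u -> phi t = phi u.
  by move=> Dt Du E; apply/seteqP; split; apply/phile/psile; rewrite ?E.
(* Any parameter of [F] may be chosen, since [phi_inj] makes the value independent of it. Sets
   without a parameter get the empty set as a default. *)
pose f F := if pselect (exists2 t, D t & F = phi t) is left e
  then psi (projT1 (cid2 e)) else classical_sets.set0.
have fE t : D t -> f (phi t) = psi t.
  move=> Dt; rewrite /f; case: pselect => [e|[]]; last by exists t.
  by case: cid2 => u Du /= E; apply: phi_inj.
exists f; split; last first.
  move=> F G /phiS[t Dt ->] /phiS[u Du ->]; rewrite !fE //.
  by rewrite phile // psile.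
split=> [F /phiS[t Dt ->]|F G|G /psiS[t Dt ->]].
- by rewrite /= fE //; exact: psiF.
- move=> /set_mem /phiS[t Dt ->] /set_mem /phiS[u Du ->]; rewrite !fE //; exact: psi_inj.
- by exists (phi t); [exact: phiF | rewrite fE].
Qed.

Lemma faces_param_prod n m (P : set 'rV[R]_n) (Q : set 'rV[R]_m)
    (T U : Type) (D : T -> Prop) (E : U -> Prop) leT leU phi psi :
  faces_param P D leT phi -> faces_param Q E leU psi ->
  faces_param (setprod P Q) (fun t : T * U => D t.1 /\ E t.2)
    (fun t u => leT t.1 u.1 /\ leU t.2 u.2) (fun t => setprod (phi t.1) (psi t.2)).
Proof.
move=> [phiF phiS phile] [psiF psiS psile]; split.
- move=> [t u] /= [Dt Eu]; apply/face_setprod; exists (phi t), (psi u).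
  by split=> //; [exact: phiF | exact: psiF].
- move=> F /face_setprod[A [B [/phiS[t Dt ->] /psiS[u Eu ->] ->]]].
  by exists (t, u).
move=> [t u] [t' u'] /= [Dt Eu] [Dt' Eu'].
rewrite -phile // -psile //; split=> [sub|[? ?]]; last exact: setprod_sub.
have [[x tx] _] := phiF _ Dt; have [[y uy] _] := psiF _ Eu.
split=> [z tz|z uz].
  by have /sub/setprod_row[] : setprod (phi t) (psi u) (row_mx z y) by apply/setprod_row.
by have /sub/setprod_row[] : setprod (phi t) (psi u) (row_mx x z) by apply/setprod_row.
Qed.

Lemma faces_param_comp n (P : set 'rV[R]_n) (T T' : Type) (D : T -> Prop)
    (D' : T' -> Prop) le le' phi (h : T' -> T) :
  faces_param P D le phi -> (forall t, D' t -> D (h t)) ->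
  (forall t, D t -> exists2 u, D' u & t = h u) ->
  (forall t u, D' t -> D' u -> (le (h t) (h u) <-> le' t u)) ->
  faces_param P D' le' (phi \o h).
Proof.
move=> [phiF phiS phile] hD hS hle; split=> [t /hD /phiF //|F|t u Dt Du].
  by move=> /phiS[t /hS[u Du ->] ->]; exists u.
by rewrite -hle // -phile //; exact: hD.
Qed.

Lemma faces_param_point :
  faces_param (@point_polytope R) (fun _ : unit => True) (fun _ _ => True) (fun=> [set: _]%classic).
Proof.
split=> //; first by move=> _ _; exact: (face_self (@point_polytope R)).
move=> F [[x Fx] _]; exists tt => //; apply/seteqP; split=> // y _.
by have -> : y = x by apply/rowP => -[].
Qed.

End FaceParametrization.

(** * Bounds on the affine dimension *)

Section AffineDimension.
Variable R : realType.
Implicit Types (n k : nat).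

Lemma affdim_ge n k (F : set 'rV[R]_n) x (M : 'M[R]_(k, n)) :
  F x -> (forall i, F (x + row i M)) -> row_free M -> (k <= affdim F)%N.
Proof.
move=> Fx FM Mfree.
have kn : (k < n.+1)%N by rewrite ltnS -(eqP Mfree) rank_leq_col.
by rewrite /affdim (leq_bigmax_cond (Ordinal kn)) //; apply/asboolP; exists x, M.
Qed.

Lemma affdim_basis n (F : set 'rV[R]_n) x0 : F x0 ->
  exists x (M : 'M[R]_(affdim F, n)), [/\ F x, forall i, F (x + row i M) & row_free M].
Proof.
move=> Fx0.
pose A := [pred k : 'I_n.+1 | `[< exists x (M : 'M[R]_(k, n)),
   [/\ F x, forall i, F (x + row i M) & row_free M] >]].
have -> : affdim F = \max_(k in A) k by [].
have A0 : (0 < #|A|)%N.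
  apply/card_gt0P; exists ord0; apply/asboolP; exists x0, 0; split=> //; first by case.
  by rewrite /row_free mxrank0.
have [k kA ->] := eq_bigmax_cond (fun k : 'I_n.+1 => k : nat) A0.
exact/asboolP.
Qed.

Lemma affdim_leq n (F : set 'rV[R]_n) : (affdim F <= n)%N.
Proof. by apply/bigmax_leqP => k _; rewrite -ltnS. Qed.

(** The functional [c] vanishes on all directions of [F] but not on [y - x] for [x] in [F]. So
    [y - x] enlarges a free family of directions of [F]. *)
Lemma affdim_lt n (F G : set 'rV[R]_n) (c : 'cV[R]_n) x0 y :
  (F `<=` G)%classic -> F x0 -> (forall x, F x -> dot c x = dot c x0) ->
  G y -> dot c y != dot c x0 -> (affdim F < affdim G)%N.
Proof.
move=> FG Fx0 Fc Gy cy; have [x [M [Fx FM Mfree]]] := affdim_basis Fx0.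
have cM : M *m c = 0.
  apply/row_matrixP => i; apply/matrixP => a b; rewrite row_mul !ord1 row0 !mxE.
  have := Fc _ (FM i); rewrite dotD (Fc _ Fx) => /eqP.
  by rewrite -subr_eq0 [_ + dot c (row i M)]addrC addrK /dot mxE => /eqP.
apply: (@affdim_ge _ (1 + affdim F) _ x (col_mx (y - x) M)); first exact: FG.
  move=> i; rewrite -(splitK i); case: (fintype.split i) => j /=.
    by rewrite rowKu ord1 (_ : row 0 _ = y - x) ?[x + _]addrC ?subrK //;
      apply/rowP => k; rewrite !mxE.
  by rewrite rowKd; exact/FG/FM.
rewrite -kermx_eq0; apply/rowV0P => v /sub_kermxP.
rewrite -{1}[v]hsubmxK mul_row_col => vM.
(* Applying [c] to a linear relation kills the rows of [M] and isolates the coefficient of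
   [y - x]. *)
have : lsubmx v *m ((y - x) *m c) = 0.
  have := congr1 (mulmx^~ c) vM; rewrite mulmxDl -!mulmxA cM mulmx0 addr0 mul0mx //.
rewrite [(y - x) *m c]mx11_scalar mul_mx_scalar -/(dot c (y - x)) dotB (Fc _ Fx).
move=> /eqP; rewrite scaler_eq0 subr_eq0 (negPf cy) /= => /eqP lv.
move: vM; rewrite lv mul0mx add0r => rv.
rewrite -[v]hsubmxK lv (_ : rsubmx v = 0) ?row_mx0 //.
by apply/eqP; move/eqP: rv; rewrite mulmx_free_eq0.
Qed.

(** The kernel of [K] has dimension at least [n - m]; a basis of it is scaled down until it fits
    into the ball around [z]. *)
Lemma affdim_ge_ball n m (F : set 'rV[R]_n) (K : 'M[R]_(n, m)) z e : 0 < e ->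
  F z -> (forall v, v *m K = 0 -> (forall i, `|v 0 i| <= e) -> F (z + v)) ->
  (n - m <= affdim F)%N.
Proof.
move=> e0 Fz Fball.
have Kge : (n - m <= \rank (kermx K))%N by rewrite mxrank_ker leq_sub2l // rank_leq_col.
apply: leq_trans Kge _; set B := row_base (kermx K).
(* [s] bounds every entry of [B]; the summand 1 keeps it positive. *)
pose s := 1 + \sum_i \sum_j `|B i j|.
have s0 : 0 < s by rewrite ltr_wpDr // sumr_ge0 // => i _; rewrite sumr_ge0.
have Bs i j : `|B i j| <= s.
  rewrite /s (bigD1 i) //= (bigD1 j) //= addrCA -addrA lerDl.
  by rewrite !addr_ge0 //; apply: sumr_ge0 => k _ //; exact: sumr_ge0.
apply: (@affdim_ge _ _ _ z ((e / s) *: B)) => //; last first.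
  by rewrite /row_free mxrank_scale_nz ?mxrank_gen ?eq_row_base // gt_eqF // divr_gt0.
move=> i; apply: Fball.
  rewrite linearZ /= -scalemxAl (_ : row i B *m K = 0) ?scaler0 //.
  by apply/sub_kermxP; apply: submx_trans (row_sub i B) _; rewrite eq_row_base.
move=> j; rewrite mxE mxE normrM ger0_norm; last by rewrite ltW // divr_gt0.
by rewrite mulrAC ler_pdivrMr // ler_pM2l // Bs.
Qed.

End AffineDimension.

(** * Faces of the associahedra *)

Section Spread.
Variables (R : realType) (V : finType).
Implicit Types (D I U : {set V}) (x y : V -> R).

(** Used in [spread]: when mass is shared evenly among [s] vertices, [u] of them still get more than
    their tube inequality demands. *)
Lemma ltn_mul_exp3 u s : (0 < u < s)%N -> (s * 3 ^ u < u * (3 ^ s - 1))%N.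
Proof.
case/andP=> u0; elim: s => // s IH; rewrite ltnS leq_eqVlt => /orP[/eqP <-|us].
  have : (3 <= 3 ^ u)%N by rewrite -{1}[3%N]expn1 leq_exp2l.
  rewrite expnS; move: (3 ^ u)%N => t t3.
  have : (0 <= (u - 1) * (t - 3))%N by [].
  rewrite !(mulnBr, mulnBl); nia.
have := IH us; rewrite expnS.
have : (0 < 3 ^ s)%N by rewrite expn_gt0.
have : (0 < 3 ^ u)%N by rewrite expn_gt0.
move: (3 ^ s)%N (3 ^ u)%N => T t t0 T0; rewrite !mulnBr !muln1 => H.
have st : (t <= s * t)%N by rewrite leq_pmull //; lia.
have uT : (u <= u * T)%N by rewrite leq_pmulr.
by rewrite mulSn mulnCA; lia.
Qed.

(** Each summand is at most a third of [3 ^+ c]. *)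
Lemma exp3_pair a b c : (a < c)%N -> (b < c)%N -> 3 ^+ a + 3 ^+ b < 3 ^+ c :> R.
Proof.
case: c => // c; rewrite !ltnS => ac bc; rewrite exprS.
have : 3 ^+ a <= 3 ^+ c :> R by rewrite ler_eXn2l ?ltr1n.
have : 3 ^+ b <= 3 ^+ c :> R by rewrite ler_eXn2l ?ltr1n.
have : 0 < 3 ^+ c :> R by rewrite exprn_gt0.
lra.
Qed.

(* Witness: [y] spreads the missing mass [3 ^ |D| - x(I)] evenly over [D :\: I]. *)
Lemma spread D I x : I \proper D -> (forall i, i \in I -> 0 <= x i) ->
    \sum_(i in I) x i <= 3 ^+ #|I| ->
  exists y, [/\ forall i, i \in I -> y i = x i, forall i, i \in D -> 0 <= y i,
    \sum_(i in D) y i = 3 ^+ #|D| &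
    forall U, U \proper D -> ~~ (U \subset I) -> 3 ^+ #|U| < \sum_(i in U) y i].
Proof.
move=> ID x0; set m := \sum_(i in I) x i => mI.
have IDs := proper_sub ID.
have [s sE] : exists s, s = #|D :\: I| by eexists.
have DE : #|D| = (s + #|I|)%N.
  by rewrite sE -(cardsID I D) (setIidPr IDs) addnC.
have s0 : (0 < s)%N by have := proper_card ID; lia.
pose q := (3 ^+ #|D| - m) / s%:R.
have sq : s%:R * q = 3 ^+ #|D| - m by rewrite /q mulrC divfK // pnatr_eq0 -lt0n.
have mD : m <= 3 ^+ #|D| :> R.
  by apply: le_trans mI _; rewrite ler_eXn2l ?ltr1n // DE leq_addl.
have q0 : 0 <= q by rewrite divr_ge0 // subr_ge0.
pose y i := if i \in I then x i else q.
have ysum U : U \subset D ->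
    \sum_(i in U) y i = \sum_(i in U :&: I) x i + #|U :\: I|%:R * q.
  move=> UD; rewrite (big_setID I) /=; congr (_ + _).
    by apply: eq_bigr => i; rewrite /y inE => /andP[_ ->].
  rewrite mulr_natl -sumr_const; apply: eq_bigr => i.
  by rewrite /y inE => /andP[/negPf ->].
have yD : \sum_(i in D) y i = 3 ^+ #|D|.
  by rewrite ysum // (setIidPr IDs) -sE sq addrC subrK.
exists y; split=> // [i iI|i iD|U UD UI].
- by rewrite /y iI.
- by rewrite /y; case: ifP => // /x0.
have UDs := proper_sub UD.
set u := #|U :\: I|.
have u0 : (0 < u)%N.
  by rewrite card_gt0 setD_eq0.
have us : (u <= s)%N by rewrite sE subset_leq_card // setSD.
have UE : #|U| = (#|U :&: I| + u)%N by rewrite -(cardsID I U).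
have UIx : 0 <= \sum_(i in U :&: I) x i.
  by apply: sumr_ge0 => i; rewrite inE => /andP[_ /x0].
rewrite ysum // -/u.
(* If [U] misses a vertex of [D :\: I], its share [u * q] alone exceeds [3 ^+ #|U|] by
   [ltn_mul_exp3]. If it misses none, its mass is at least [3 ^+ #|D| - 3 ^+ #|I|], which suffices
   by [exp3_pair]. *)
move: us; rewrite leq_eqVlt => /orP[/eqP us|us]; last first.
  have key : (s * 3 ^ u)%:R + 1 <= (u * 3 ^ s)%:R - u%:R :> R.
    have := @ltn_mul_exp3 u s; rewrite u0 us => /(_ isT).
    rewrite mulnBr muln1 => H; rewrite lerBrDr natr1 -natrD ler_nat; lia.
  have UIle : (#|U| <= u + #|I|)%N by rewrite UE addnC leq_add2l subset_leq_card ?subsetIr.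
  have s0R : 0 < s%:R :> R by rewrite ltr0n.
  have : s%:R * 3 ^+ #|U| < u%:R * (3 ^+ #|D| - m) :> R.
    apply: (@le_lt_trans _ _ (s%:R * 3 ^+ (u + #|I|))).
      by rewrite ler_pM2l // ler_eXn2l ?ltr1n.
    apply: (@lt_le_trans _ _ (u%:R * (3 ^+ #|D| - 3 ^+ #|I|))); last first.
      by rewrite ler_pM2l ?ltr0n // lerB.
    rewrite DE !exprD -[X in _ < _ * (_ - X)]mul1r -mulrBl !mulrA.
    rewrite ltr_pM2r ?exprn_gt0 //.
    move: key; rewrite !natrM !natrX; lra.
  rewrite -sq mulrCA ltr_pM2l // => H; lra.
have UDI : U :\: I = D :\: I by apply/eqP; rewrite eqEcard setSD //= -sE -us.
have : \sum_(i in U) y i = 3 ^+ #|D| - m + \sum_(i in U :&: I) x i.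
  by rewrite ysum // -/u us sq addrC.
rewrite ysum // -/u => ->.
have UC := proper_card UD; have IC := proper_card ID.
have := @exp3_pair _ _ _ UC IC; lra.
Qed.

(** Recursion along the largest tube [C]: a point built on [C] for [N :\ C] is extended to [D] by
    [spread], which leaves every set not inside [C] strictly slack. When [N] has only leaves, each
    of them gets mass 3 and one application of [spread] is enough. *)
Lemma tight_point (L D : {set V}) N : nested L N -> ~~ (D \subset L) ->
    (forall S, S \in N -> S \proper D) ->
  exists y : V -> R, [/\ forall i, i \in D -> 0 <= y i,
    \sum_(i in D) y i = 3 ^+ #|D| &
    forall U, U \proper D -> tube L U -> 3 ^+ #|U| <= \sum_(i in U) y i /\
      (\sum_(i in U) y i = 3 ^+ #|U| <-> U \in N)].
Proof.
have [k] := ubnP #|D|; elim: k D N => // k IH D N Dk nN DL ND.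
have [tN cN] := nestedP _ _ nN.
have [NL|[C [CN CL NC]]] := nested_top nN.
  pose I := [set i | [set i] \in N].
  have ID : I \proper D.
    rewrite properEneq; apply/andP; split.
      apply: contraNneq DL => <-; apply/subsetP => i; rewrite inE => /NL.
      by rewrite sub1set.
    by apply/subsetP => i; rewrite inE => /ND /proper_sub; rewrite sub1set.
  have [||y [yI y0 yD yU]] := @spread D I (fun=> 3) ID.
  - by [].
  - rewrite sumr_const; case: #|I| => [|j]; first by rewrite mulr0n ltW.
    rewrite -[_ *+ _]mulr_natr -natrM -natrX ler_nat.
    elim: j => // j IHj; rewrite expnS mulnS; apply: leq_trans (leq_add (leqnn 3) IHj) _.
    have : (3 <= 3 ^ j.+1)%N by rewrite expnS leq_pmulr ?expn_gt0.
    lia.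
  exists y; split=> // U UD tU.
  have [UI|UI] := boolP (U \subset I); last first.
    have lt := yU _ UD UI; split; first exact: ltW.
    split=> [E|UN]; first by move: lt; rewrite E ltxx.
    have [i _ UE] := tube_leaf tU (NL _ UN).
    by move: UI; rewrite UE sub1set inE -UE UN.
  have IL : I \subset L by apply/subsetP => i; rewrite inE => /NL; rewrite sub1set.
  have [i _ UE] := tube_leaf tU (subset_trans UI IL).
  have iI : i \in I by rewrite -sub1set -UE.
  rewrite UE cards1 big_set1 expr1 (yI _ iI); split=> //; split=> // _.
  by move: iI; rewrite inE.
have CD := ND _ CN.
have [||||x [x0 xC xU]] := IH C (N :\ C).
- by rewrite (leq_trans (proper_card CD)) // -ltnS.
- exact: nestedS (subD1set _ _) nN.
- by [].
- by move=> S; rewrite in_setD1 properEneq => /andP[-> /NC].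
have [||y [yI y0 yD yU]] := @spread D C x CD.
- exact: x0.
- by rewrite xC.
exists y; split=> // U UD tU.
have [UC|UC] := boolP (U \subset C); last first.
  have lt := yU _ UD UC; split; first exact: ltW.
  split=> [E|UN]; first by move: lt; rewrite E ltxx.
  by move: UC; rewrite NC.
have -> : \sum_(i in U) y i = \sum_(i in U) x i.
  by apply: eq_bigr => i /(subsetP UC); exact: yI.
have [->|UneqC] := eqVneq U C; first by rewrite xC.
have UCp : U \proper C by rewrite properEneq UneqC.
by have := xU _ UCp tU; rewrite in_setD1 UneqC.
Qed.

End Spread.

(** * Faces of the associahedron attached to [L], and their codimension *)

Section SplitGraphAssociahedron.
Variables (R : realType) (n : nat) (L : {set 'I_n.+1}).
Hypothesis LT : L != setT.
Implicit Types (S T U : {set 'I_n.+1}) (N M : {set {set 'I_n.+1}}) (x y : 'rV[R]_n.+1).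

Definition mass x S : R := \sum_(i in S) x 0 i.

Definition indic S : 'cV[R]_n.+1 := \col_i (i \in S)%:R.

Lemma dot_indic S x : dot (indic S) x = mass x S.
Proof.
rewrite /dot mxE [RHS]big_mkcond /=; apply: eq_bigr => i _.
by rewrite mxE; case: (i \in S); rewrite ?mulr1 ?mulr0.
Qed.

Lemma massD x y S : mass (x + y) S = mass x S + mass y S.
Proof. by rewrite -!dot_indic dotD. Qed.

Definition split_assoc : set 'rV[R]_n.+1 := fun x =>
  mass x setT = 3 ^+ n.+1 /\ forall S, tube L S -> 3 ^+ #|S| <= mass x S.

Definition split_face N : set 'rV[R]_n.+1 := fun x =>
  split_assoc x /\ forall S, S \in N -> mass x S = 3 ^+ #|S|.

Lemma split_face0 : split_face set0 = split_assoc.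
Proof.
by apply/seteqP; split=> [x []//|x Px]; split=> // S; rewrite inE.
Qed.

Lemma split_faceS N M : M \subset N -> (split_face N `<=` split_face M)%classic.
Proof. by move=> /subsetP MN x [Px xN]; split=> // S /MN /xN. Qed.

Lemma split_face_point N : nested L N -> exists2 x, split_assoc x &
  forall S, tube L S -> (mass x S = 3 ^+ #|S| <-> S \in N).
Proof.
move=> nN; have [tN _] := nestedP _ _ nN.
have DL : ~~ (setT \subset L) by rewrite subTset.
have prop S : tube L S -> S \proper setT.
  by move=> /and3P[_ ST _]; rewrite properEneq ST subsetT.
have [S /tN /prop //|y [y0 yT yU]] := tight_point R nN DL.
have yE S : mass (\row_i y i) S = \sum_(i in S) y i.
  by apply: eq_bigr => i _; rewrite mxE.
exists (\row_i y i) => [|S tS]; last by rewrite yE; case: (yU S (prop _ tS) tS).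
split; first by rewrite yE yT cardsT card_ord.
by move=> S tS; rewrite yE; case: (yU S (prop _ tS) tS).
Qed.

Lemma split_assoc_ge0 x i : split_assoc x -> 0 <= x 0 i.
Proof.
move=> [xT xS]; rewrite (_ : x 0 i = mass x [set i]); last by rewrite /mass big_set1.
have [iT|iT] := eqVneq [set i] setT.
  by rewrite iT xT exprn_ge0.
apply: le_trans (xS [set i] _); first by rewrite exprn_ge0.
by rewrite /tube cards1 iT orbT -card_gt0 cards1.
Qed.

(* [3 ^ |S|] grows so fast that two tight tubes cannot cross. *)
Lemma tight_compat x S T : split_assoc x -> tube L S -> tube L T ->
  mass x S = 3 ^+ #|S| -> mass x T = 3 ^+ #|T| -> compat L S T.
Proof.
move=> Px tS tT xS xT; apply: contraT; rewrite /compat !negb_or => /and3P[ST TS STL].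
have SU : S \proper S :|: T by rewrite properE subsetUl subUset subxx.
have TU : T \proper S :|: T by rewrite properE subsetUr subUset subxx andbT.
have UL : ~~ (S :|: T \subset L) by rewrite subUset.
have xU : 3 ^+ #|S :|: T| <= mass x (S :|: T).
  have [->|UT] := eqVneq (S :|: T) setT.
    by rewrite cardsT card_ord Px.1.
  apply: Px.2; rewrite /tube UT UL andbT /=; case/and3P: tS => S0 _ _.
  by rewrite setU_eq0 negb_and S0.
have : mass x (S :|: T) <= mass x S + mass x T.
  rewrite /mass [X in X <= _]big_mkcond [X in _ <= X + _]big_mkcond.
  rewrite [X in _ <= _ + X]big_mkcond -big_split /=; apply: ler_sum => i _.
  have := split_assoc_ge0 i Px; rewrite inE.
  by case: (i \in S); case: (i \in T) => /=; lra.
have := exp3_pair R (proper_card SU) (proper_card TU); rewrite xS xT; lra.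
Qed.

Definition split_halfspaces N : seq ('cV[R]_n.+1 * R) :=
  [:: (indic setT, 3 ^+ n.+1); (- indic setT, - 3 ^+ n.+1)] ++
  [seq (- indic T, - 3 ^+ #|T|) | T : {set 'I_n.+1} <- enum (tube L)] ++
  [seq (indic T, 3 ^+ #|T|) | T : {set 'I_n.+1} <- enum N].

Lemma split_face_halfspaces N : nested L N ->
  split_face N = halfspaces (split_halfspaces N).
Proof.
move=> /nestedP[tN _]; apply/seteqP; split=> [x [[xT xS] xN] h|x H].
  rewrite !mem_cat !inE -orbA.
  case/or4P=> [/eqP->|/eqP->|/mapP[S]|/mapP[S]] /=.
  - by rewrite dot_indic xT.
  - by rewrite dotN dot_indic xT.
  - by rewrite mem_enum => tS -> /=; rewrite dotN dot_indic lerN2 xS.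
  - by rewrite mem_enum => tS -> /=; rewrite dot_indic xN.
have xS S : tube L S -> 3 ^+ #|S| <= mass x S.
  move=> tS; have := H (- indic S, - 3 ^+ #|S|).
  rewrite !mem_cat [X in _ || (X || _)]map_f ?orbT ?mem_enum // => /(_ isT).
  by rewrite /= dotN dot_indic lerN2.
split; [split=> // |] => [|S SN]; apply/eqP; rewrite eq_le.
  have := H _ (mem_head _ _); rewrite /= dot_indic => ->.
  have := H (- indic setT, - 3 ^+ n.+1); rewrite !mem_cat !inE eqxx orbT /= => /(_ isT).
  by rewrite dotN dot_indic lerN2.
have := H (indic S, 3 ^+ #|S|).
rewrite !mem_cat [X in _ || (_ || X)]map_f ?orbT ?mem_enum // => /(_ isT).
by rewrite /= dot_indic => ->; exact/xS/tN.
Qed.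

Lemma split_face_polytope N : nested L N -> is_polytope (split_face N).
Proof.
move=> nN; have [tN _] := nestedP _ _ nN; split.
- have [x Px xN] := split_face_point nN; exists x; split=> // S SN.
  exact/(xN _ (tN _ SN)).
- exists (3 ^+ n.+1) => x [Px _] i.
  rewrite ger0_norm ?split_assoc_ge0 // -Px.1 /mass (bigD1 i) ?inE //= lerDl.
  by apply: sumr_ge0 => j _; exact: split_assoc_ge0.
- by exists (split_halfspaces N); exact: split_face_halfspaces.
Qed.

(** The point whose tight tubes are exactly those of [N] detects every tube of [M]. *)
Lemma split_face_subE N M : nested L N -> nested L M ->
  (split_face N `<=` split_face M)%classic <-> M \subset N.
Proof.
move=> nN nM; split; last exact: split_faceS.
have [[tN _] [tM _]] := (nestedP _ _ nN, nestedP _ _ nM).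
have [x Px xN] := split_face_point nN.
have Nx : split_face N x by split=> // S SN; apply/(xN _ (tN _ SN)).
by move=> /(_ _ Nx)[_ xM]; apply/subsetP => S SM; apply/(xN _ (tM _ SM))/xM.
Qed.

(** The functional is minus the sum of the masses of the tubes of [M]. The tube inequalities bound
    it from above, with equality exactly when all these tubes are tight. *)
Lemma is_face_split_face N M : nested L M -> N \subset M ->
  is_face (split_face N) (split_face M).
Proof.
move=> nM NM; have [[z Mz] _ _] := split_face_polytope nM; split; first by exists z.
have [tM _] := nestedP _ _ nM.
pose c := - \sum_(S in M) indic S.
have cE x : dot c x = - \sum_(S in M) mass x S.
  rewrite /c dotN /dot mulmx_sumr summxE; congr (- _); apply: eq_bigr => S _.
  by rewrite -dot_indic.
have cM x : split_face M x -> dot c x = - \sum_(S in M) 3 ^+ #|S|.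
  by move=> [_ xM]; rewrite cE; congr (- _); apply: eq_bigr => S /xM.
exists c; apply/seteqP; split=> [x Mx|x [[Px xN] xmax]].
  split=> [|y [Py yN]]; first exact: split_faceS Mx.
  rewrite (cM x Mx) cE lerN2; apply: ler_sum => S /tM tS; exact: Py.2.
split=> // S SM; apply/eqP; rewrite eq_le Px.2 ?tM // andbT.
have := xmax z (split_faceS NM Mz); rewrite (cM z Mz) cE lerN2.
rewrite (bigD1 S) //= [leRHS](bigD1 S) //=.
have : \sum_(T in M | T != S) 3 ^+ #|T| <= \sum_(T in M | T != S) mass x T.
  by apply: ler_sum => T /andP[/tM tT _]; exact: Px.2.
lra.
Qed.

(** [M] collects the tubes that are tight on all of [F]. It is nested by [tight_compat], and a face
    is cut out by the inequalities tight on it. *)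
Lemma split_face_onto N F : nested L N -> is_face (split_face N) F ->
  exists M, [/\ nested L M, N \subset M & F = split_face M].
Proof.
move=> nN FF; have [[y Fy] _] := FF; have FN := face_sub FF.
have [tN _] := nestedP _ _ nN.
pose M := [set S | tube L S & `[< forall x, F x -> mass x S = 3 ^+ #|S| >]].
have tightM S : S \in M -> forall x, F x -> mass x S = 3 ^+ #|S|.
  by rewrite inE => /andP[_ /asboolP].
have tM S : S \in M -> tube L S by rewrite inE => /andP[].
have NM : N \subset M.
  apply/subsetP => S SN; rewrite inE tN //=; apply/asboolP => x /FN[_]; exact.
exists M; split=> //.
  apply/nestedP; split=> [S /tM //|S T SM TM].
  by apply: (@tight_compat y); rewrite ?tM ?tightM //; case: (FN _ Fy).
rewrite (face_tight (split_face_polytope nN) FF (split_face_halfspaces nN)).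
apply/seteqP; split=> [x [Nx xt]|x Mx].
  split=> [|S SM]; first by case: Nx.
  rewrite -dot_indic; have xn : dot (- indic S) x = - 3 ^+ #|S|.
    apply: (xt (- indic S, - 3 ^+ #|S|)).
      rewrite !mem_cat [X in _ || (X || _)]map_f ?orbT ?mem_enum //; exact: tM.
    by move=> z Fz /=; rewrite dotN dot_indic tightM.
  by apply: oppr_inj; rewrite -dotN.
split=> [|h]; first exact: split_faceS Mx.
have [[[xT xS] _] [_ xM]] := (split_faceS NM Mx, Mx).
rewrite !mem_cat !inE -orbA.
case/or4P=> [/eqP->|/eqP->|/mapP[S]|/mapP[S]] /=.
- by rewrite dot_indic xT.
- by rewrite dotN dot_indic xT.
- rewrite mem_enum => tS -> /= FS; rewrite dotN dot_indic xM //.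
  rewrite inE; apply/andP; split=> //; apply/asboolP => z /FS.
  by rewrite dotN dot_indic => /oppr_inj.
- by rewrite mem_enum => /(subsetP NM)/xM xSE -> /= _; rewrite dot_indic.
Qed.

Lemma split_face_param N : nested L N ->
  faces_param (split_face N) (fun M => nested L M /\ N \subset M)
    (fun M M' : {set {set 'I_n.+1}} => M' \subset M) split_face.
Proof.
move=> nN; split=> [M [nM NM]|F /(split_face_onto nN)[M [nM NM ->]]|M M' [nM _] [nM' _]].
- exact: is_face_split_face.
- by exists M.
- exact: split_face_subE.
Qed.

(** Around a point tight exactly on [N], small moves that keep the total mass and the masses of [N]
    stay in the face. These are at most [#|N| + 1] equations in [n + 1] coordinates. *)
Lemma affdim_split_face_ge N : nested L N -> (n - #|N| <= affdim (split_face N))%N.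
Proof.
move=> nN; have [tN _] := nestedP _ _ nN; have [z Pz zN] := split_face_point nN.
pose N' := setT |: N.
pose K : 'M[R]_(n.+1, #|N'|) := \matrix_(i, j) (i \in (enum_val j : {set 'I_n.+1}))%:R.
have vK v : v *m K = 0 -> forall S, S \in N' -> mass v S = 0.
  move=> vK S SN'; rewrite -dot_indic.
  have := congr1 (fun A : 'rV[R]_#|N'| => A 0 (enum_rank_in SN' S)) vK.
  rewrite [RHS]mxE => <-; rewrite /dot !mxE; apply: eq_bigr => i _.
  by rewrite !mxE enum_rankK_in.
(* [e] is the least slack of [z] over the tubes outside [N], capped by the default 1 and divided by
   the number of coordinates. A move of at most [e] in each coordinate then exhausts no slack. *)
have [e e0 eP] : exists2 e : R, 0 < e & forall S, tube L S -> S \notin N ->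
    e *+ n.+1 <= mass z S - 3 ^+ #|S|.
  pose e := \big[Num.min/1]_(S | tube L S && (S \notin N)) (mass z S - 3 ^+ #|S|).
  have e0 : 0 < e.
    apply: (big_ind (fun r => 0 < r)) => // [a b a0 b0|S /andP[tS SN]].
      by rewrite lt_min a0.
    rewrite subr_gt0 lt_neqAle Pz.2 // andbT.
    by apply: contra SN => /eqP/esym/(zN _ tS).
  exists (e / n.+1%:R) => [|S tS SN]; first by rewrite divr_gt0.
  rewrite -[leLHS]mulr_natr divfK ?pnatr_eq0 //.
  by apply: bigmin_le_cond; rewrite tS.
have cN' : (#|N'| <= #|N|.+1)%N by rewrite cardsU1; case: (_ \notin _).
apply: leq_trans (affdim_ge_ball (K := K) (z := z) e0 _ _).
- by rewrite leq_subLR; lia.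
- by split=> // S SN; apply/(zN _ (tN _ SN)).
move=> v /vK v0 ve; split; [split|] => [|S tS|S SN].
- by rewrite massD v0 ?addr0 ?Pz.1 // /N' !inE eqxx.
- rewrite massD; have [SN|SN] := boolP (S \in N).
    by rewrite v0 ?addr0 ?Pz.2 // /N' inE SN orbT.
  have : - (e *+ n.+1) <= mass v S.
    rewrite lerNl -sumrN; apply: (@le_trans _ _ (\sum_(i : 'I_n.+1) e)).
      rewrite /mass big_mkcond; apply: ler_sum => i _; case: ifP => _; last exact: ltW.
      by apply: le_trans (ve i); rewrite -normrN ler_norm.
    by rewrite sumr_const card_ord.
  have := eP _ tS SN; lra.
- by rewrite massD v0 ?addr0 /N' ?inE ?SN ?orbT //; apply/(zN _ (tN _ SN)).
Qed.

(** Induction on [N]: releasing one tube strictly raises the dimension, because some point of the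
    larger face is not tight on that tube. *)
Lemma affdim_split_face_le N : nested L N -> (affdim (split_face N) + #|N| <= n)%N.
Proof.
have [k] := ubnP #|N|; elim: k N => // k IH N Nk nN.
have [tN _] := nestedP _ _ nN; have [x Px xN] := split_face_point nN.
have Nx : split_face N x by split=> // S SN; apply/(xN _ (tN _ SN)).
have [N0|/set0Pn[S SN]] := eqVneq N set0.
  (* The polytope lies in the hyperplane of total mass [3 ^+ n.+1], which misses the origin, so its
     dimension is less than [n + 1]. *)
  rewrite N0 cards0 addn0 -ltnS -N0; apply: leq_trans (affdim_leq (classical_sets.setT)).
  apply: (@affdim_lt _ _ _ _ (indic setT) x 0) => //.
    by move=> y [[yT _] _]; rewrite !dot_indic yT Px.1.
  by rewrite [X in _ != X]dot_indic Px.1 /dot mul0mx mxE eq_sym expf_neq0 // pnatr_eq0.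
have nS : nested L (N :\ S) by apply: nestedS nN; exact: subD1set.
have [y Py yN] := split_face_point nS.
have cN : #|N| = #|N :\ S|.+1 by rewrite (cardsD1 S N) SN.
have := IH (N :\ S); rewrite -ltnS -cN => /(_ Nk nS).
suff : (affdim (split_face N) < affdim (split_face (N :\ S)))%N by lia.
apply: (@affdim_lt _ _ _ _ (indic S) x y) => //.
- by apply: split_faceS; exact: subD1set.
- by move=> z [_ zN]; rewrite !dot_indic zN // (Nx.2 _ SN).
- split=> // T TN; apply/yN => //; apply: tN; move: TN; rewrite inE => /andP[] //.
rewrite !dot_indic (Nx.2 _ SN); apply/eqP => /(yN _ (tN _ SN)).
by rewrite !inE eqxx.
Qed.

Lemma codim_split_face N : nested L N ->
  codim (split_face set0) (split_face N) = #|N|.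
Proof.
move=> nN; rewrite /codim.
have := affdim_split_face_ge nN; have := affdim_split_face_le nN.
have := affdim_split_face_ge (nested0 L); have := affdim_split_face_le (nested0 L).
by rewrite cards0; lia.
Qed.

End SplitGraphAssociahedron.

Arguments split_assoc R [n] L.
Arguments split_face R [n] L N.

(** * Complete graphs and stars as instances *)

Section SplitGraphs.
Variable R : realType.

Lemma graph_assoc_split n (G : connected_graph n.+1) (L : {set 'I_n.+1}) :
    (forall S : {set 'I_n.+1}, S != set0 -> S != setT ->
      (induced_connected G S <-> ~~ (S \subset L) || (#|S| == 1))) ->
  graph_assoc_set G = split_assoc R L.
Proof.
move=> GL; have sT (x : 'rV[R]_n.+1) : mass x setT = \sum_i x 0 i.
  by apply: eq_bigl => i; rewrite inE.
apply/seteqP; split=> x [xT xS]; split; rewrite ?sT // -?xT //.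
  move=> S /and3P[S0 ST SL]; apply: xS => //; last exact/GL.
  by rewrite properEneq ST subsetT.
move=> S S0; rewrite properEneq subsetT andbT => ST SL; apply: xS.
by rewrite /tube S0 ST /=; apply/GL.
Qed.

Lemma complete_split n :
  graph_assoc_set (complete_graph n.+1) = split_assoc R set0.
Proof.
apply: graph_assoc_split => S S0 _; rewrite subset0 S0; split=> // _ x y xS yS.
have [->|xy] := eqVneq x y; first exact: connect0.
by apply: connect1; rewrite /= xS yS.
Qed.

Lemma star_split n :
  graph_assoc_set (star_graph n) = split_assoc R (~: [set ord0]).
Proof.
have subE (S : {set 'I_n.+1}) : (S \subset ~: [set ord0]) = (ord0 \notin S).
  apply/subsetP/idP => [S0|S0 i iS].
    by apply/negP => /S0; rewrite !inE eqxx.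
  by rewrite !inE; apply: contraNneq S0 => <-.
apply: graph_assoc_split => S /set0Pn[x xS] _; rewrite subE negbK.
split=> [Sconn|/orP[S0|/cards1P[z ->]]].
- have [//|S0] := boolP (ord0 \in S); rewrite orFb; apply/cards1P; exists x.
  apply/setP => y; rewrite inE; apply/idP/eqP => [yS|-> //].
  (* The first edge of a path inside [S] would have the centre as an endpoint, but the centre is not
     in [S]. *)
  have /connectP[[|z p] /= ep ->] := Sconn _ _ xS yS; first by [].
  move/andP: ep => [/and3P[_ zS /andP[_ /orP[/eqP xE|/eqP zE]]] _].
    by rewrite -xE xS in S0.
  by rewrite -zE zS in S0.
- move=> {x xS} x y xS yS; apply: (@connect_trans _ _ ord0).
    have [->|x0] := eqVneq x ord0; first exact: connect0.
    by apply: connect1; rewrite /= xS S0 /star_rel x0 eqxx orbT.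
  have [->|y0] := eqVneq y ord0; first exact: connect0.
  by apply: connect1; rewrite /= yS S0 /star_rel eq_sym y0 eqxx.
- by move=> a b /set1P-> /set1P->; exact: connect0.
Qed.

End SplitGraphs.

(** * Classes of faces in the polytope ring *)

Section FaceClasses.
Variable R : realType.

(** Made total in [N] so that it can stand under sums; the default for a family that is not nested
    is the whole associahedron. *)
Definition split_polytope n (L : {set 'I_n.+1}) (LT : L != setT)
    (N : {set {set 'I_n.+1}}) : polytope R n.+1 :=
  if pselect (nested L N) is left nN then Polytope (split_face_polytope R LT nN)
  else Polytope (split_face_polytope R LT (nested0 L)).

Lemma split_polytopeE n (L : {set 'I_n.+1}) (LT : L != setT) N : nested L N ->
  body (split_polytope LT N) = split_face R L N.
Proof. by rewrite /split_polytope; case: pselect. Qed.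

Lemma motivic_interior_split n (L : {set 'I_n.+1}) (LT : L != setT)
    (Q : polytope R n.+1) : body Q = split_assoc R L ->
  motivic_interior Q =
    \sum_(N | nested L N) (-1) ^+ #|N| * poly_class (split_polytope LT N).
Proof.
move=> QL; have Q0 : body Q = split_face R L set0 by rewrite split_face0.
rewrite /motivic_interior (reindex_fsbig (split_polytope LT) [set` enum (nested L)]%classic).
  rewrite -(fsbig_seq _ (fun N => _) (enum_uniq (nested L))).
  rewrite big_enum; apply: eq_bigr => N nN.
  by rewrite (split_polytopeE LT nN) Q0 (codim_split_face R LT nN).
split.
- move=> N /=; rewrite mem_enum => nN; rewrite /faces /= Q0 split_polytopeE //.
  by apply: is_face_split_face; rewrite ?sub0set.
- move=> N M /set_mem /=; rewrite mem_enum => nN /set_mem /=; rewrite mem_enum => nM.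
  move=> /(congr1 (@body _ _)); rewrite !split_polytopeE // => NM.
  apply/eqP; rewrite eqEsubset; apply/andP.
  by split; apply/(split_face_subE R LT); rewrite ?NM.
- move=> F; rewrite /faces /= Q0 => /(split_face_onto LT (nested0 L))[N [nN _ FE]].
  exists N; first by rewrite /= mem_enum.
  by apply: polytope_inj; rewrite split_polytopeE.
Qed.

Lemma poly_class_eq n m (P : polytope R n) (Q : polytope R m) :
  comb_equiv P Q -> poly_class P = poly_class Q.
Proof. by move=> /eq_class PQ; rewrite /poly_class PQ. Qed.

Lemma split_param n (L : {set 'I_n.+1}) (LT : L != setT) N : nested L N ->
  faces_param (split_polytope LT N) (fun M => nested L M /\ N \subset M)
    (fun M M' : {set {set 'I_n.+1}} => M' \subset M) (split_face R L).
Proof. by move=> nN; rewrite split_polytopeE //; exact: split_face_param. Qed.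

(* A tube [C] splits the faces on which it is tight into those of the
   restriction to [C] and those of the contraction, a permutohedron. *)
Lemma poly_class_relabel n k m (L : {set 'I_n.+1}) (LT : L != setT)
    (f : 'I_k.+1 -> 'I_n.+1) (L1 : {set 'I_k.+1}) (LT1 : L1 != setT)
    (LT0 : set0 != setT :> {set 'I_m.+1}) M :
    injective f -> L1 = f @^-1: L -> (k.+1 + m.+1 = n.+1)%N -> nested L1 M ->
  poly_class (split_polytope LT (relabel f M)) =
    poly_class (split_polytope LT1 M) * poly_class (split_polytope LT0 set0).
Proof.
move=> f_inj L1E kmn nM; set C := f @: setT.
have CL : ~~ (C \subset L) by rewrite imset_subL -L1E subTset.
have cC : #|~: C| = m.+1.
  by have := cardsC C; rewrite card_imset // cardsT !card_ord; lia.
have [c cC'] : exists c, c \in ~: C by apply/card_gt0P; rewrite cC.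
have [g [g_inj gC _]] := set_bij_ord cC' cC.
have CT : C != setT by apply: contraTneq cC' => ->; rewrite !inE.
have hyp : [/\ ~~ (C \subset L), C != setT, set0 = set0 :> {set 'I_n.+1} & [set C] = [set C]] \/
  [/\ C \subset L, set0 = L & [set C] = leaves C] by left.
have L2E : g @^-1: set0 = set0 by rewrite preimset0.
have low K : {in relabel f K, forall S : {set 'I_n.+1}, S \subset C}.
  by move=> S; exact: relabel_sub.
subst L1; rewrite -poly_class_prod; apply: poly_class_eq.
have nR K : nested (f @^-1: L) K -> nested L (relabel f K) by exact: nested_relabel.
apply: comb_equiv_param (faces_param_prod (split_param LT1 nM) (split_param LT0 (nested0 _))).
apply: (faces_param_comp (h := fun t => join_nested g set0 C (relabel f t.1) t.2)
  (split_param LT (nR _ nM))).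
- move=> [K K2] /= [[nK MK] [nK2 _]]; split.
    by apply: (nested_join g_inj gC hyp); rewrite ?L2E //; exact: nR.
  by apply: subset_trans (subsetUl _ _); rewrite (relabel_subE f_inj nM nK).
- move=> N [nN MN].
  have CN : [set C] \subset N.
    by rewrite sub1set (subsetP MN) // in_relabel eqxx.
  have [B [K2 [nB BC CB nK2 NE]]] := join_nested_onto g_inj gC LT hyp nN CN.
  have [|K nK BE] := relabel_onto f_inj nB _ BC; first by rewrite -sub1set.
  exists (K, K2); last by rewrite NE BE.
  split=> /=; split; rewrite ?sub0set -?L2E //.
  rewrite -(relabel_subE f_inj nM nK).
  (* [relabel f M] is a join with nothing above [C], so [join_nested_subE] turns its inclusion in
     [N] into one in [B]. *)
  have : join_nested g set0 C (relabel f M) set0 \subset join_nested g set0 C B K2.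
    by rewrite -NE /join_nested imset0 setU0.
  rewrite (join_nested_subE g_inj gC (low M) BC (nested0 _) nK2) BE.
  by case/andP.
move=> [K K2] [K' K2'] /= [[nK _] [nK2 _]] [[nK' _] [nK2' _]].
rewrite -L2E in nK2 nK2'.
rewrite (join_nested_subE g_inj gC (low K') (low K) nK2' nK2).
by rewrite (relabel_subE f_inj nK' nK); split=> [/andP[]|[-> ->]].
Qed.

(** A nested set below [A] that contains [leaves A] equals it, since tubes inside [A] are single
    leaves. Only the contraction is left to vary. *)
Lemma poly_class_leaves n m (L A : {set 'I_n.+1}) (LT : L != setT)
    (g : 'I_m.+1 -> 'I_n.+1) (L2 : {set 'I_m.+1}) (LT2 : L2 != setT) :
    injective g -> g @: setT = ~: A -> A \subset L -> L2 = g @^-1: L ->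
  poly_class (split_polytope LT (leaves A)) = poly_class (split_polytope LT2 set0).
Proof.
move=> g_inj gA AL L2E.
have hyp : [/\ ~~ (A \subset L), A != setT, L = set0 & leaves A = [set A]] \/
  [/\ A \subset L, L = L & leaves A = leaves A] by right.
have nA := nested_leaves LT AL.
have low : {in leaves A, forall S : {set 'I_n.+1}, S \subset A}.
  by move=> _ /imsetP[i iA ->]; rewrite sub1set.
(* The point stands for the trivial lower factor and brings the goal into product form. *)
rewrite -[RHS]mul1r -[1]/(poly_class (point_polytope R)) -poly_class_prod.
subst L2; apply: poly_class_eq.
apply: comb_equiv_param
  (faces_param_prod (faces_param_point R) (split_param LT2 (nested0 _))).
apply: (faces_param_comp (h := fun t => join_nested g L A (leaves A) t.2)
  (split_param LT nA)).
- move=> [[] K] /= [_ [nK _]]; split; last exact: subsetUl.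
  exact: (nested_join g_inj gA hyp).
- move=> N [nN AN].
  have [B [K [nB BA AB nK NE]]] := join_nested_onto g_inj gA LT hyp nN AN.
  exists (tt, K); first by rewrite /= sub0set.
  rewrite NE; congr (_ :|: _); apply/eqP; rewrite eqEsubset AB andbT.
  apply/subsetP => S SB; have [tB _] := nestedP _ _ nB.
  have [i _ SE] := tube_leaf (tB _ SB) (subset_trans (BA _ SB) AL).
  by rewrite SE mem_leaves -sub1set -SE BA.
move=> [[] K] [[] K'] /= [_ [nK _]] [_ [nK' _]].
by rewrite (join_nested_subE g_inj gA) // subxx; split=> [|[]].
Qed.

End FaceClasses.

(** * Generating series *)

Section Recurrences.
Variable R : realType.

Lemma set0_neqT n : set0 != setT :> {set 'I_n.+1}.
Proof. by rewrite eq_sym; apply/set0Pn; exists ord0; rewrite inE. Qed.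

Lemma star_neqT n : ~: [set ord0] != setT :> {set 'I_n.+1}.
Proof. by apply/eqP => /setP /(_ ord0); rewrite !inE. Qed.

Lemma card_star n : #|~: [set ord0] : {set 'I_n.+1}| = n.
Proof. by have := cardsC [set ord0 : 'I_n.+1]; rewrite cards1 card_ord => -[]. Qed.

Lemma stellohedronE n : stellohedron R n = split_polytope R (star_neqT n) set0.
Proof.
by apply: polytope_inj; rewrite split_polytopeE ?nested0 // split_face0 -star_split.
Qed.

Lemma permutohedronE n : permutohedron R n = split_polytope R (set0_neqT n) set0.
Proof.
by apply: polytope_inj; rewrite split_polytopeE ?nested0 // split_face0 -complete_split.
Qed.

Lemma motivic_interior_stellohedron n : motivic_interior (stellohedron R n) =
  \sum_(N | nested (~: [set ord0]) N)
    (-1) ^+ #|N| * poly_class (split_polytope R (star_neqT n) N).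
Proof. by apply: motivic_interior_split; exact: star_split. Qed.

Lemma motivic_interior_permutohedron n : motivic_interior (permutohedron R n) =
  \sum_(N | nested set0 N) (-1) ^+ #|N| * poly_class (split_polytope R (set0_neqT n) N).
Proof. by apply: motivic_interior_split; exact: complete_split. Qed.

(** The minus sign is the contribution of the tube [f @: setT] itself, one member more than in the
    restriction. *)
Lemma sum_faces_tube n k m (L : {set 'I_n.+1}) (LT : L != setT)
    (f : 'I_k.+1 -> 'I_n.+1) (L1 : {set 'I_k.+1}) (LT1 : L1 != setT) :
    injective f -> L1 = f @^-1: L -> (k.+1 + m.+1 = n.+1)%N ->
  \sum_(N | [&& nested L N, f @: setT \in N & [forall S in N, S \subset f @: setT]])
    (-1) ^+ #|N| * poly_class (split_polytope R LT N) =
  - ((\sum_(M | nested L1 M) (-1) ^+ #|M| * poly_class (split_polytope R LT1 M)) *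
     poly_class (permutohedron R m)).
Proof.
move=> f_inj L1E kmn; rewrite sum_nested_relabel //.
- rewrite mulr_suml -sumrN -L1E; apply: eq_bigr => M nM.
  rewrite (poly_class_relabel R LT LT1 (set0_neqT m) f_inj L1E kmn nM).
  rewrite L1E in nM; rewrite (card_relabel f_inj nM) exprS mulN1r permutohedronE.
  by rewrite mulNr mulrA.
- by rewrite imset_subL -L1E subTset.
apply/eqP => fT; have := card_imset [set: 'I_k.+1] f_inj.
by rewrite fT !cardsT !card_ord; lia.
Qed.

(** Indexed by the number of vertices, one more than the index of [permutohedron]; value 1 on no
    vertices is the constant term of the series. *)
Definition perm_class k : polytope_ring R :=
  if k is m.+1 then poly_class (permutohedron R m) else 1.

Definition perm_interior k : polytope_ring R :=
  if k is m.+1 then - motivic_interior (permutohedron R m) else 1.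

(** The empty nested set gives the permutohedron itself. Each possible largest tube [C] gives a
    product, whose sign is absorbed into [perm_interior]. *)
Lemma interior_permutohedron_rec n : motivic_interior (permutohedron R n) =
  poly_class (permutohedron R n) +
  \sum_(C : {set 'I_n.+1} | (C != set0) && (C != setT))
    perm_interior #|C| * perm_class (n.+1 - #|C|).
Proof.
rewrite motivic_interior_permutohedron (sum_nested (set0_neqT n)); congr (_ + _).
  under eq_bigl => B do rewrite subset0.
  by rewrite big_pred1_eq /leaves imset0 cards0 expr0 mul1r -permutohedronE.
apply: eq_big => [C|C /andP[C0 CT]]; first by rewrite subset0.
rewrite subset0 in C0; have [c cC] := set0Pn _ C0.
have [k kE] : exists k, #|C| = k.+1.
  by exists #|C|.-1; rewrite prednK // card_gt0.
have kn : (k < n)%N.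
  have : (#|C| < #|[set: 'I_n.+1]|)%N by rewrite proper_card // properEneq CT subsetT.
  by rewrite kE cardsT card_ord.
have [f [f_inj fC _]] := set_bij_ord cC kE.
have [m mE] : exists m, (n.+1 - #|C| = m.+1)%N by exists (n - #|C|)%N; lia.
have kmn : (k.+1 + m.+1 = n.+1)%N by lia.
have L1E : set0 = f @^-1: set0 by rewrite preimset0.
rewrite mE kE -fC (sum_faces_tube (set0_neqT n) (set0_neqT k) f_inj L1E kmn).
by rewrite -motivic_interior_permutohedron -mulNr.
Qed.

Lemma permutohedron_recurrence n :
  \sum_(k < n.+2) (perm_interior k * perm_class (n.+1 - k)) *+ 'C(n.+1, k) = 0.
Proof.
have := sum_subset_card [set: 'I_n.+1] (fun k => perm_interior k * perm_class (n.+1 - k)).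
rewrite cardsT card_ord => <-.
have T0 : setT != set0 :> {set 'I_n.+1} by rewrite eq_sym set0_neqT.
under eq_bigl => B do rewrite subsetT.
(* The terms of the empty and the full set are the class and minus the interior, and the recursion
   above says that they cancel the rest. *)
rewrite (bigD1 set0) //= (bigD1 setT) //= cards0 cardsT card_ord.
rewrite subn0 subnn mul1r mulr1 /= interior_permutohedron_rec.
by rewrite opprD addrA addrA subrr add0r addrC subrr.
Qed.

Lemma star_subset n (S : {set 'I_n.+1}) : (S \subset ~: [set ord0]) = (ord0 \notin S).
Proof. by rewrite -disjoints_subset disjoint_sym disjoints1. Qed.

(** A nested set of leaves [B] contracts to a star with [n - #|B|] leaves. Otherwise the largest
    tube is the centre together with a proper subset [B] of the leaves, and it restricts to a star
    with [#|B|] leaves. *)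
Lemma interior_stellohedron_rec n : motivic_interior (stellohedron R n) =
  \sum_(B : {set 'I_n.+1} | B \subset ~: [set ord0])
    (-1) ^+ #|B| * poly_class (stellohedron R (n - #|B|)) -
  \sum_(B : {set 'I_n.+1} | (B \subset ~: [set ord0]) && (B != ~: [set ord0]))
    motivic_interior (stellohedron R #|B|) * perm_class (n - #|B|).
Proof.
apply: etrans (motivic_interior_stellohedron n) _.
apply: etrans (sum_nested (star_neqT n) _) _.
apply: (congr2 +%R).
  apply: eq_bigr => B BL; rewrite card_leaves; congr (_ * _).
  have cB : #|~: B| = (n - #|B|).+1.
    have := subset_leq_card BL; have := cardsC B; rewrite card_star card_ord; lia.
  have B0 : ord0 \in ~: B by rewrite inE -star_subset.
  have [g [g_inj gB g0]] := set_bij_ord B0 cB.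
  have L2E : ~: [set ord0] = g @^-1: ~: [set ord0].
    by apply/setP => i; rewrite !inE -g0 inj_eq.
  rewrite (poly_class_leaves R (star_neqT n) (star_neqT (n - #|B|)) g_inj gB BL L2E).
  by rewrite [in RHS]stellohedronE.
rewrite (reindex_onto (fun B => ord0 |: B) (fun C => C :\ ord0)) /=; last first.
  by move=> C; rewrite star_subset negbK => /andP[C0 _]; rewrite setD1K.
rewrite -sumrN; apply: eq_big => [B|B].
  rewrite !star_subset !inE eqxx /=.
  have [B0|B0] := boolP (ord0 \in B).
    apply/negbTE; rewrite negb_and orbC; apply/orP; left; apply/eqP => E.
    have := setD11 ord0 (ord0 |: B).
    by rewrite E B0.
  rewrite setU1K // eqxx andbT /=; congr (~~ _); apply/eqP/eqP => [BT|->]; last first.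
    by rewrite setUCr.
  apply/setP => i; have /setP/(_ i) := BT; rewrite !inE.
  by have [->|_ /= ->] := eqVneq i ord0; first by rewrite (negPf B0).
move=> /andP[/andP[_ BT] /eqP BE].
have B0 : ord0 \notin B by rewrite -BE setD11.
have kE : #|ord0 |: B| = #|B|.+1 by rewrite cardsU1 B0.
have kn : (#|B| < n)%N.
  have : (#|ord0 |: B| < #|[set: 'I_n.+1]|)%N by rewrite proper_card // properEneq BT subsetT.
  by rewrite kE cardsT card_ord.
have [f [f_inj fC f0]] := set_bij_ord (setU11 ord0 B) kE.
have [m mE] : exists m, (n - #|B| = m.+1)%N by exists (n - #|B|.+1)%N; lia.
have kmn : (#|B|.+1 + m.+1 = n.+1)%N by lia.
have L1E : ~: [set ord0] = f @^-1: ~: [set ord0].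
  by apply/setP => i; rewrite !inE -f0 inj_eq.
rewrite mE -fC (sum_faces_tube (star_neqT n) (star_neqT #|B|) f_inj L1E kmn).
by rewrite [motivic_interior _]motivic_interior_stellohedron.
Qed.

(** The second sum of the recursion is moved to the left, where the interior of the stellohedron
    itself supplies the missing term for the set of all leaves. *)
Lemma stellohedron_recurrence n :
  \sum_(k < n.+1)
    (motivic_interior (stellohedron R k) * perm_class (n - k)) *+ 'C(n, k) =
  \sum_(k < n.+1) ((-1) ^+ k * poly_class (stellohedron R (n - k))) *+ 'C(n, k).
Proof.
set L : {set 'I_n.+1} := ~: [set ord0].
have E1 := sum_subset_card L
  (fun k => motivic_interior (stellohedron R k) * perm_class (n - k)).
have E2 := sum_subset_card L
  (fun k => (-1) ^+ k * poly_class (stellohedron R (n - k))).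
have cL : #|L| = n by exact: card_star.
rewrite cL in E1 E2; apply: etrans (esym E1) (etrans _ E2).
have E0 : motivic_interior (stellohedron R #|L|) * perm_class (n - #|L|) =
    motivic_interior (stellohedron R n).
  by rewrite cL subnn /perm_class mulr1.
apply: etrans (bigD1 (P := fun B : {set 'I_n.+1} => B \subset L) L (subxx L)) _.
apply: etrans (congr2 +%R (etrans E0 (interior_stellohedron_rec n)) (erefl _)) _.
exact: subrK.
Qed.

End Recurrences.

(** * Passage to exponential generating series over the rationals *)

Section Series.
Variable R : realType.

(** Names the basis map inside [toQ] so that multiplicativity can be attached to it, which makes
    [toQ] a ring morphism. *)
Definition mono_class (k : comb_type R) : polytope_ringQ R := << k >>.

Fact mono_class_morphism : mmorphism mono_class.
Proof. by split=> [k l|//]; rewrite /mono_class malgM_def fgmulUU mulr1. Qed.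

HB.instance Definition _ := monalg.isMultiplicative.Build (comb_type R) (polytope_ringQ R)
  mono_class mono_class_morphism.

Lemma toQM (p q : polytope_ring R) : toQ (p * q) = toQ p * toQ q.
Proof.
exact: (@mmap_is_multiplicative (comb_type R) int (polytope_ringQ R)
  (intmul 1) mono_class).1.
Qed.

Lemma toQ1 : toQ (1 : polytope_ring R) = 1.
Proof.
exact: (@mmap_is_multiplicative (comb_type R) int (polytope_ringQ R)
  (intmul 1) mono_class).2.
Qed.

Lemma toQB : {morph @toQ R : p q / p - q}.
Proof.
exact: (@mmap_is_additive (comb_type R) int (polytope_ringQ R)
  (intmul 1) mono_class).
Qed.

HB.instance Definition _ := GRing.isZmodMorphism.Build (polytope_ring R)
  (polytope_ringQ R) (@toQ R) toQB.
HB.instance Definition _ := GRing.isMonoidMorphism.Build (polytope_ring R)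
  (polytope_ringQ R) (@toQ R) (toQ1, toQM).

Lemma egfM (a b c : nat -> polytope_ringQ R) :
    (forall n, c n = \sum_(k < n.+1) (a k * b (n - k)%N) *+ 'C(n, k)) ->
  egf a * egf b = egf c.
Proof.
move=> abc; apply: fpsP => n; rewrite fcoefM /= abc scaler_sumr.
apply: eq_bigr => k _; rewrite -scalerAl -scalerAr scalerA -scaler_nat scalerA.
congr (_ *: _); have kn : (k <= n)%N by rewrite -ltnS.
(* The binomial coefficient divided by [n!] is the product of the inverses of [k!] and
   [(n - k)!]. *)
rewrite -(bin_fact kn) !natrM !invfM mulrAC mulVf ?mul1r //.
by rewrite pnatr_eq0 -lt0n bin_gt0.
Qed.

Lemma egf_toQM (a b c : nat -> polytope_ring R) :
    (forall n, c n = \sum_(k < n.+1) (a k * b (n - k)%N) *+ 'C(n, k)) ->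
  egf (fun n => toQ (a n)) * egf (fun n => toQ (b n)) = egf (fun n => toQ (c n)).
Proof.
move=> abc; apply: egfM => n; rewrite abc rmorph_sum; apply: eq_bigr => k _.
by rewrite rmorphMn rmorphM.
Qed.

Lemma Pi_seriesE : Pi_series R = egf (fun n => toQ (perm_class R n)).
Proof.
rewrite /Pi_series; congr egf; apply/funext => -[|n]; first exact: esym toQ1.
exact: erefl.
Qed.

Lemma Pio_seriesE : Pio_series R = egf (fun n => toQ (perm_interior R n)).
Proof.
rewrite /Pio_series; congr egf; apply/funext => -[|n]; first exact: esym toQ1.
by rewrite /perm_interior rmorphN.
Qed.

Lemma exp_NxE : exp_Nx R = egf (fun n => toQ ((-1) ^+ n)).
Proof. by congr egf; apply/funext => n; rewrite rmorphXn rmorphN1. Qed.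

Lemma Pio_Pi : Pio_series R * Pi_series R = 1.
Proof.
rewrite Pi_seriesE Pio_seriesE (egf_toQM (c := fun n => (n == 0%N)%:R)).
  apply: fpsP => n; rewrite fcoef1 /=.
  case: n => [|n] /=; last by rewrite (rmorph0 (@toQ R)) scaler0.
  by rewrite toQ1 fact0 invr1 scale1r.
case=> [|n]; last by rewrite permutohedron_recurrence.
by rewrite big_ord_recl big_ord0 /= addr0 mulr1.
Qed.

Lemma So_Pi : So_series R * Pi_series R = exp_Nx R * S_series R.
Proof.
rewrite Pi_seriesE exp_NxE.
exact: etrans (egf_toQM (a := fun n => motivic_interior (stellohedron R n))
  (fun n => erefl)) (esym (egf_toQM (b := fun n => poly_class (stellohedron R n))
  (@stellohedron_recurrence R))).
Qed.

End Series.

Theorem theorem7p1 (R : realType) :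
  So_series R = exp_Nx R * Pio_series R * S_series R /\
  exp_Nx R * Pio_series R * S_series R =
    exp_Nx R * (Pi_series R)^-1 * S_series R.
Proof.
(* Both equalities are formal: [q * p = 1] identifies [q] with the inverse of [p], and
   [so * p = e * s] is then multiplied by [q]. *)
have div (A : comUnitRingType) (so e p q s : A) :
    q * p = 1 -> so * p = e * s -> so = e * q * s /\ e * q * s = e * p^-1 * s.
  move=> qp sop; have pq : p * q = 1 by rewrite mulrC.
  have pU : p \is a GRing.unit by apply/unitrP; exists q.
  have -> : p^-1 = q by rewrite -[LHS]mul1r -qp mulrK.
  by rewrite mulrAC -sop -mulrA pq mulr1.
exact: div (Pio_Pi R) (So_Pi R).
Qed.
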